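(* Let $G$ be a graph of treewidth $t$ and let $\mathcal H,\mathcal K$ be two non-piercing families of subgraphs of $G$. Then $(G,\mathcal H,\mathcal K)$ admits an intersection support $\tilde Q$ with $\mathrm{tw}(\tilde Q)\le 2^{2^{t+4}+4(t+1)}$.
   Context: All graphs are finite and simple. A subgraph $H$ of a graph $G$ is identified with its vertex set $V(H)$ (subgraphs are taken to be induced), and intersections, differences and containments of subgraphs refer to their vertex sets. A family $\mathcal H$ of subgraphs of $G$ is non-piercing if every $H\in\mathcal H$ induces a connected subgraph of $G$ and, for all $H,H'\in\mathcal H$, the induced subgraph $G[V(H)\setminus V(H')]$ is connected (an empty vertex set is regarded as connected). For families $\mathcal H,\mathcal K$ of subgraphs of $G$ and $K\in\mathcal K$, let $\mathcal H_K=\{H\in\mathcal H: V(H)\cap V(K)\ne\emptyset\}$. An intersection support for $(G,\mathcal H,\mathcal K)$ is a graph $\tilde Q$ with vertex set $\mathcal H$ such that $\tilde Q[\mathcal H_K]$ is connected for every $K\in\mathcal K$. $\mathrm{tw}$ denotes treewidth. *)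

(* Defs.v *)
From mathcomp Require Import all_boot.
Set Implicit Arguments. Unset Strict Implicit. Unset Printing Implicit Defensive.

Definition simple_graph (V : finType) (e : rel V) : Prop :=
  symmetric e /\ irreflexive e.

Definition induced (V : finType) (e : rel V) (S : {set V}) : rel V :=
  [rel x y | [&& e x y, x \in S & y \in S]].

(* S induces a connected subgraph of (V, e); the empty set is connected. *)
Definition connected_in (V : finType) (e : rel V) (S : {set V}) : Prop :=
  forall x y, x \in S -> y \in S -> connect (induced e S) x y.

(* A tree on a finite nonempty index type I: a connected simple graph with
   exactly |I| - 1 (unordered) edges. *)
Definition is_tree (I : finType) (r : rel I) : Prop :=
  [/\ simple_graph r, 0 < #|I|, connected_in r [set: I] &
      #|[set p : I * I | r p.1 p.2]| = 2 * (#|I| - 1)].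

Definition tree_decomposition_width_le (V : finType) (W : {set V}) (e : rel V)
    (I : finType) (r : rel I) (B : I -> {set V}) (k : nat) : Prop :=
  is_tree r /\
  (forall i, B i \subset W) /\
  (forall v, v \in W -> exists i, v \in B i) /\
  (forall u v, u \in W -> v \in W -> e u v -> exists i, (u \in B i) && (v \in B i)) /\
  (forall v, v \in W -> connected_in r [set i | v \in B i]) /\
  (forall i, #|B i| <= k.+1).

Definition tw_le (V : finType) (W : {set V}) (e : rel V) (k : nat) : Prop :=
  exists (I : finType) (r : rel I) (B : I -> {set V}),
    tree_decomposition_width_le W e r B k.

(* tw(W, e) = t (treewidth of the empty graph is taken to be 0). *)
Definition treewidth_eq (V : finType) (W : {set V}) (e : rel V) (t : nat) : Prop :=
  tw_le W e t /\ forall k, tw_le W e k -> t <= k.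

(* A non-piercing family of subgraphs (identified with vertex sets) of G. *)
Definition non_piercing (V : finType) (e : rel V) (Hs : {set {set V}}) : Prop :=
  (forall H, H \in Hs -> connected_in e H) /\
  (forall H H', H \in Hs -> H' \in Hs -> connected_in e (H :\: H')).

Definition meeting (V : finType) (Hs : {set {set V}}) (K : {set V}) : {set {set V}} :=
  [set H in Hs | H :&: K != set0].

Definition intersection_support (V : finType) (Hs Ks : {set {set V}})
    (Q : rel {set V}) : Prop :=
  simple_graph Q /\
  (forall H H', Q H H' -> (H \in Hs) && (H' \in Hs)) /\
  forall K, K \in Ks -> connected_in Q (meeting Hs K).

(* Main.v *)
Require Import Defs.
From mathcomp Require Import all_boot zify.
Set Implicit Arguments. Unset Strict Implicit. Unset Printing Implicit Defensive.

(** The tree of a decomposition of [G] is first made binary.  If two members of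
a non-piercing family have the same trace on the adhesion of an arc of the
tree, their difference is connected and avoids the adhesion, so it lies on one
side of the arc; this makes the members with a given trace almost a chain.

Let [S] be the union of [Hs].  For an arc and a trace, among the members of
[Ks] meeting [S] on both sides take one whose near part is smallest.  A vertex
of [S] in it can be carried along from the arcs behind, and every crossing
member of [Ks] contains the vertex carried by the arc or by its reverse.
Adding the carried vertices to the bags makes every [K :&: S] connected while
[Hs] stays non-piercing.

In the new decomposition every member of [Hs] receives a home node, at most
six per node and trace (plus the empty set), so that two members with the same
trace on an arc and homes on the same side of it are comparable beyond it.
For every arc and trace a representative with the largest far part is carried
along the tree.  The bags made of the homes and the representatives decompose
the support in which two members are adjacent when they share a bag. *)

(** * Connectivity and counting tools *)

Lemma connected_cut (T : finType) (e : rel T) (X D : {set T}) (x y : T) :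
  connected_in e X -> x \in X -> y \in X -> x \in D -> y \notin D ->
  exists u w, [/\ u \in X, w \in X, e u w, u \in D & w \notin D].
Proof.
move=> cX xX yX xD yD; have /connectP[s ps ys] := cX _ _ xX yX.
elim: s x xX xD ps ys => [|z s IHs] x xX xD /=; first by move=> _ ey; rewrite ey xD in yD.
case/andP=> /and3P[exz _ zX] pz yz.
have [zD|zD] := boolP (z \in D); first exact: IHs zX zD pz yz.
by exists x, z.
Qed.

Lemma connect_homo_gen (S T : finType) (e : rel S) (e' : rel T) (f : S -> T) x y :
  (forall a b, e a b -> connect e' (f a) (f b)) ->
  connect e x y -> connect e' (f x) (f y).
Proof.
move=> h /connectP[s ps ->]; elim: s x ps => [|z s IHs] x //= /andP[exz pz].
by apply: connect_trans (h _ _ exz) (IHs _ pz).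
Qed.

Lemma card_fibers (S T : finType) (A : {set S}) (Y : {set T}) (f : S -> T) k :
  (forall x, x \in A -> f x \in Y) ->
  (forall y, y \in Y -> #|[set x in A | f x == y]| <= k) -> #|A| <= k * #|Y|.
Proof.
move=> fAY hk; rewrite -sum1_card (partition_big f (mem Y)) //=.
rewrite mulnC -sum_nat_const; apply: leq_sum => y yY.
apply: leq_trans (hk y yY); rewrite -sum1_card; apply: eq_leq; apply: eq_bigl => x.
by rewrite inE.
Qed.

(** * Rooted binary trees *)

(* Node [0] is the root and parents have smaller indices; [lab] tells the at most two children of a node apart. *)
Record btree (N : nat) := BTree {
  par : 'I_N.+1 -> 'I_N.+1;
  lab : 'I_N.+1 -> bool;
  par0 : par ord0 = ord0;
  par_lt : forall i, i != ord0 -> par i < i;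
  lab_inj : forall c d, c != ord0 -> d != ord0 -> par c = par d -> lab c = lab d -> c = d }.

Arguments par_lt {N b i}.
Arguments lab_inj {N b c d}.

Section BinaryTree.
Variables (N : nat) (T : btree N).
Local Notation I := 'I_N.+1.
Implicit Types i j k c d : I.

Definition desc c : {set I} := [set i | fconnect (par T) i c].
Definition tadj : rel I := [rel i j | (i != j) && ((par T i == j) || (par T j == i))].
(** For adjacent [i] and [j], the component of [i] after deleting the edge between them. The test
    recognises arcs going up; any other arc is read as going down to [j]. *)
Definition side i j : {set I} :=
  if (i != ord0) && (par T i == j) then desc i else ~: desc j.

Lemma par_le i : par T i <= i.
Proof. by have [->|/(par_lt (b := T))/ltnW//] := eqVneq i ord0; rewrite par0. Qed.

Lemma node_ind (P : I -> Prop) :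
  (forall i, (i != ord0 -> P (par T i)) -> P i) -> forall i, P i.
Proof.
move=> h i; have [n] := ubnP (val i); elim: n i => // n IHn i ltin.
apply: h => i0; apply: IHn; exact: leq_trans (par_lt i0) ltin.
Qed.

Lemma desc_refl c : c \in desc c. Proof. by rewrite inE. Qed.

Lemma desc_trans i j k : i \in desc j -> j \in desc k -> i \in desc k.
Proof. by rewrite !inE; apply: connect_trans. Qed.

Lemma desc_par i c : par T i \in desc c -> i \in desc c.
Proof. by apply: desc_trans; rewrite inE fconnect1. Qed.

Lemma desc_step i c : i \in desc c -> i != c -> i != ord0 /\ par T i \in desc c.
Proof.
rewrite !inE => /iter_findex; case: (findex _ _ _) => [|n]; first by move=> /= ->; rewrite eqxx.
rewrite iterSr => ec ic; split; last by rewrite -ec fconnect_iter.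
apply: contraNneq ic => i0; rewrite -ec i0 par0.
by elim: n {ec} => //= n /eqP <-; rewrite par0.
Qed.

Lemma desc_root i : i \in desc ord0.
Proof.
elim/node_ind: i => i IHi; have [->|/IHi] := eqVneq i ord0; first exact: desc_refl.
exact: desc_par.
Qed.

Lemma desc_le i c : i \in desc c -> c <= i.
Proof.
elim/node_ind: i => i IHi ic; have [->//|nic] := eqVneq i c.
have [i0 pic] := desc_step ic nic.
exact: leq_trans (IHi i0 pic) (par_le i).
Qed.

Lemma desc_linear k c d : k \in desc c -> k \in desc d -> c \in desc d \/ d \in desc c.
Proof.
elim/node_ind: k => k IHk kc kd; have [<-|nkc] := eqVneq k c; first by left.
have [<-|nkd] := eqVneq k d; first by right.
have [k0 pkc] := desc_step kc nkc; have [_ pkd] := desc_step kd nkd.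
exact: IHk.
Qed.

Lemma desc_child k c : k \in desc c -> k != c ->
  exists c', [/\ c' != ord0, par T c' = c & k \in desc c'].
Proof.
elim/node_ind: k => k IHk kc nkc; have [k0 pkc] := desc_step kc nkc.
have [epk|npk] := eqVneq (par T k) c; first by exists k; split=> //; apply: desc_refl.
have [c' [c0 ec' pc']] := IHk k0 pkc npk.
by exists c'; split=> //; apply: desc_par.
Qed.

Lemma par_notin_desc c : c != ord0 -> par T c \notin desc c.
Proof. by move=> c0; apply/negP=> /desc_le; rewrite leqNgt par_lt. Qed.

Lemma child_desc c : c \in desc (par T c).
Proof. by apply: desc_par; apply: desc_refl. Qed.

Lemma siblings_disjoint c d k : c != ord0 -> d != ord0 -> par T c = par T d -> c != d ->
  k \in desc c -> k \notin desc d.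
Proof.
move=> c0 d0 ecd ncd kc; apply/negP=> kd.
case: (desc_linear kc kd) => [cd|dc].
  by have [_] := desc_step cd ncd; rewrite ecd (negPf (par_notin_desc d0)).
have [_] : d != ord0 /\ par T d \in desc c by apply: desc_step => //; rewrite eq_sym.
by rewrite -ecd (negPf (par_notin_desc c0)).
Qed.

Lemma tadj_sym : symmetric tadj.
Proof. by move=> i j; rewrite /tadj /= eq_sym orbC. Qed.

Lemma tadj_par c : c != ord0 -> tadj c (par T c).
Proof.
move=> c0; rewrite /tadj /= eqxx andbT; apply: contraTneq (par_lt (b := T) c0) => ec.
by rewrite -ec ltnn.
Qed.

Variant tadj_spec : I -> I -> Prop :=
  | TadjUp c of c != ord0 : tadj_spec c (par T c)
  | TadjDown c of c != ord0 : tadj_spec (par T c) c.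

Lemma tadjP i j : tadj i j -> tadj_spec i j.
Proof.
case/andP=> nij /orP[]/eqP e.
  rewrite -e; constructor; apply: contraNneq nij => i0.
  by rewrite -e i0 par0.
rewrite -e; constructor; apply: contraNneq nij => j0.
by rewrite -e j0 par0.
Qed.

Lemma side_up c : c != ord0 -> side c (par T c) = desc c.
Proof. by move=> c0; rewrite /side c0 eqxx. Qed.

Lemma side_down c : c != ord0 -> side (par T c) c = ~: desc c.
Proof.
move=> c0; rewrite /side; case: ifP => // /andP[_ /eqP e].
have := par_lt (b := T) c0; have := par_le (par T c); rewrite e; lia.
Qed.

Lemma side_compl i j : tadj i j -> side j i = ~: side i j.
Proof. by case/tadjP=> c c0; rewrite side_up // side_down // setCK. Qed.

Lemma side_refl i j : tadj i j -> i \in side i j.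
Proof.
case/tadjP=> c c0; first by rewrite side_up // desc_refl.
by rewrite side_down // inE par_notin_desc.
Qed.

Lemma tadj_desc c u w : tadj u w -> u \in desc c -> w \notin desc c ->
  [/\ c != ord0, u = c & w = par T c].
Proof.
case/tadjP=> d d0 ud wd; last by rewrite (desc_trans (child_desc d) ud) in wd.
have edc : d = c by apply: contraNeq wd => ndc; have [] := desc_step ud ndc.
by rewrite -edc.
Qed.

Lemma side_cross i j u w : tadj i j -> tadj u w -> u \in side i j -> w \notin side i j ->
  u = i /\ w = j.
Proof.
case/tadjP=> c c0 uw; first by rewrite side_up // => uc wc; case: (tadj_desc uw uc wc).
rewrite side_down // !inE negbK => uc wc.
by rewrite tadj_sym in uw; case: (tadj_desc (c := c) uw) => //; rewrite inE.
Qed.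

Lemma nbr_side i k : k != i -> exists2 c, tadj c i & k \in side c i.
Proof.
move=> nki; have [ki|nk] := boolP (k \in desc i).
  have [c [c0 <- kc]] := desc_child ki nki.
  by exists c; rewrite ?side_up // tadj_par.
have i0 : i != ord0 by apply: contraNneq nk => ->; apply: desc_root.
by exists (par T i); [rewrite tadj_sym tadj_par | rewrite side_down // inE].
Qed.

Lemma side_sub i j c : tadj i j -> tadj c i -> c != j -> side c i \subset side i j.
Proof.
case/tadjP=> d d0 /tadjP; last first.
  move=> cd ncd; rewrite side_down //; move: cd ncd.
  move e: (par T d) => q cd; case: cd e => {c q} c c0 e ncd.
    rewrite side_up //; apply/subsetP=> k kc; rewrite inE.
    by apply: siblings_disjoint kc.
  rewrite side_down // setCS; apply/subsetP=> k kd; apply: desc_trans kd _.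
  by rewrite -e child_desc.
move e: d d0 => d' d0 cd; case: cd e d0 => {c d'} c c0 e d0 ncd.
  rewrite side_up // -e side_up ?e //; apply/subsetP=> k kd; apply: desc_trans kd _.
  exact: child_desc.
by rewrite eqxx in ncd.
Qed.

Lemma side_next i j k : tadj i j -> k \in side i j -> k != i ->
  exists c, [/\ tadj c i, c != j & k \in side c i].
Proof.
move=> tij kij nki; have [c tci kci] := nbr_side nki; exists c; split=> //.
apply: contraTneq kci => ->; rewrite side_compl // inE negbK; exact: kij.
Qed.

Lemma side_card i j c : tadj i j -> tadj c i -> c != j -> #|side c i| < #|side i j|.
Proof.
move=> tij tci ncj; apply: proper_card; apply/properP; split; first exact: side_sub.
by exists i; [apply: side_refl | rewrite -in_setC -side_compl // side_refl // tadj_sym].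
Qed.

Lemma side_subC i j c : tadj i j -> tadj c i -> c != j -> side j i \subset side i c.
Proof.
move=> tij tci ncj; rewrite (side_compl tij) (side_compl tci) setCS; exact: side_sub.
Qed.

(** The arcs with [i0] behind and [j0] ahead are those of the tree path from [i0] to [j0], in this
    direction. *)
Definition towards i0 j0 : rel I :=
  [rel k k' | [&& tadj k k', i0 \in side k k' & j0 \in side k' k]].

Lemma connect_towards i0 j0 : connect (towards i0 j0) i0 j0.
Proof.
have step n k k' : #|side k' k| <= n -> towards i0 j0 k k' -> connect (towards i0 j0) k j0.
  elim: n k k' => [|n IHn] k k' len /and3P[tkk i0k j0k].
    by move: len; rewrite leqn0 cards_eq0 => /eqP e; rewrite e inE in j0k.
  apply: connect_trans (connect1 (_ : towards i0 j0 k k')) _; first exact/and3P.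
  have tkk' : tadj k' k by rewrite tadj_sym.
  have [->|nj] := eqVneq j0 k'; first exact: connect0.
  have [c [tck nck j0c]] := side_next tkk' j0k nj.
  apply: (IHn _ c); first by rewrite -ltnS (leq_trans _ len) // side_card.
  apply/and3P; split=> //; first by rewrite tadj_sym.
  exact: (subsetP (side_subC tkk' tck nck)).
have [->|nij] := eqVneq j0 i0; first exact: connect0.
have [c tci jc] := nbr_side nij.
apply: (step _ _ c (leqnn _)); apply/and3P; split=> //; rewrite 1?tadj_sym //.
by apply: side_refl; rewrite tadj_sym.
Qed.

Lemma tadj_irr : irreflexive tadj. Proof. by move=> i; rewrite /tadj /= eqxx. Qed.

Lemma tadj_degree i : #|[set j | tadj i j]| <= 3.
Proof.
pose K := [set c | (c != ord0) && (par T c == i)].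
have sub : [set j | tadj i j] \subset par T i |: K.
  apply/subsetP=> j; rewrite !inE => /tadjP[] c c0; first by rewrite eqxx.
  by rewrite c0 eqxx orbT.
apply: leq_trans (subset_leq_card sub) _; apply: leq_trans (leq_card_setU _ _) _.
rewrite cards1 -[3]/(1 + 2) leq_add2l -card_bool.
rewrite -(@card_in_imset _ _ (lab T) K) ?max_card // => c d.
rewrite !inE => /andP[c0 /eqP ec] /andP[d0 /eqP ed] el.
by apply: lab_inj el => //; rewrite ec ed.
Qed.

Lemma tadj_is_tree : is_tree tadj.
Proof.
split; first by split; [apply: tadj_sym | apply: tadj_irr].
- by rewrite card_ord.
- move=> i j _ _; apply: connect_homo_gen (connect_towards i j) => k k' /and3P[tkk _ _].
  by apply: connect1; rewrite /induced /= !inE !andbT.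
pose U := [set c | c != ord0 :> I].
pose f c := (c, par T c); pose g c := (par T c, c).
have cU : #|U| = N.
  have := cardC1 (ord0 : I); rewrite card_ord /=; apply: etrans.
  by apply: eq_card => c; rewrite !inE.
have fi : injective f by move=> c d [].
have gi : injective g by move=> c d [].
have -> : [set q : I * I | tadj q.1 q.2] = f @: U :|: g @: U.
  apply/setP=> -[i j]; rewrite in_set in_setU [(i, j).1]/= [(i, j).2]/=.
  apply/idP/orP=> [/tadjP[] c c0|[]/imsetP[c]].
  - by left; apply/imsetP; exists c; rewrite ?inE.
  - by right; apply/imsetP; exists c; rewrite ?inE.
  - by rewrite inE => c0 [-> ->]; apply: tadj_par.
  - by rewrite inE => c0 [-> ->]; rewrite tadj_sym; apply: tadj_par.
rewrite cardsU !card_imset // cU card_ord subn1 /= [X in _ - X](_ : _ = 0); last first.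
  apply/eqP; rewrite cards_eq0; apply/eqP/setP=> -[i j]; rewrite [in RHS]inE in_setI.
  apply/andP=> -[/imsetP[c cU' [-> ->]] /imsetP[d dU' [e1 e2]]].
  move: cU' dU'; rewrite !inE => c0 d0.
  by have := par_lt (b := T) c0; have := par_lt (b := T) d0; rewrite -e1 -e2 => /ltnW; rewrite leqNgt => /negP.
by rewrite subn0 mul2n addnn.
Qed.

End BinaryTree.

(** * Bags and separations *)

(** Induction on the size of [side T i j], which drops strictly on passing to an arc that enters [i]
    from behind. *)
Lemma arc_ind N (T : btree N) (P : 'I_N.+1 -> 'I_N.+1 -> Prop) :
  (forall i j, tadj T i j -> (forall c, tadj T c i -> c != j -> P c i) -> P i j) ->
  forall i j, tadj T i j -> P i j.
Proof.
move=> h i j; have [n] := ubnP #|side T i j|.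
elim: n i j => // n IHn i j ltn tij; apply: h => // c tci ncj.
by apply: IHn => //; apply: leq_trans (side_card tij tci ncj) _.
Qed.

(** Every bag becomes a clique, loops included. Connectivity for this relation survives any
    enlargement of the bags. *)
Definition shares (I V : finType) (B : I -> {set V}) : rel V :=
  [rel u v | [exists i, (u \in B i) && (v \in B i)]].

Section Bags.
Variables (N : nat) (T : btree N) (V : finType) (B : 'I_N.+1 -> {set V}).
Local Notation I := 'I_N.+1.
Implicit Types (i j k c d : I) (F : {set {set V}}) (H X : {set V}).

Definition coherent := forall v, connected_in (tadj T) [set i | v \in B i].
Definition part i j := \bigcup_(k in side T i j) B k.
Definition adh i j := part i j :&: part j i.

Lemma mem_part v k i j : v \in B k -> k \in side T i j -> v \in part i j.
Proof. by move=> vk kij; apply/bigcupP; exists k. Qed.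

Lemma part_sub i j c d : side T c d \subset side T i j -> part c d \subset part i j.
Proof.
move=> /subsetP sub; apply/subsetP=> v /bigcupP[k kc vk].
by apply: mem_part vk _; apply: sub.
Qed.

Lemma adhC i j : adh i j = adh j i. Proof. exact: setIC. Qed.

Lemma part_cover v k i j : tadj T i j -> v \in B k -> v \in part i j \/ v \in part j i.
Proof.
move=> tij vk; have [kij|kij] := boolP (k \in side T i j); first by left; apply: mem_part vk kij.
by right; apply: mem_part vk _; rewrite (side_compl tij) inE.
Qed.

Hypothesis cohB : coherent.

Lemma adh_bag i j : tadj T i j -> adh i j \subset B i.
Proof.
move=> tij; apply/subsetP=> v /setIP[/bigcupP[k kij vk] /bigcupP[l lji vl]].
have [] := @connected_cut _ _ _ (side T i j) k l (@cohB v); rewrite ?inE //.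
  by rewrite (side_compl tij) inE in lji.
move=> u [w []]; rewrite !inE => vu vw tuw us ws.
by have [<- _] := side_cross tij tuw us ws.
Qed.

Lemma adh_bagr i j : tadj T i j -> adh i j \subset B j.
Proof. by move=> tij; rewrite adhC adh_bag // tadj_sym. Qed.

(** A walk in [X] out of [part i j] has a step inside one bag; whichever side of the arc that bag is
    on, a vertex of the step ends up in the adhesion or the step does not leave. *)
Lemma separated i j X x y : tadj T i j -> connected_in (shares B) X ->
  (forall z, z \in X -> z \in adh i j -> False) ->
  x \in X -> y \in X -> x \in part i j -> y \in part j i -> False.
Proof.
move=> tij cX Xadh xX yX xij yji.
have yij : y \notin part i j.
  by apply/negP=> yij; apply: (Xadh y yX); rewrite in_setI yij.
have [u [w [uX wX /existsP[k /andP[uk wk]] uij wij]]] := connected_cut cX xX yX xij yij.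
have [kij|kij] := boolP (k \in side T i j).
  by rewrite (mem_part wk kij) in wij.
apply: (Xadh u uX); rewrite in_setI uij /=; apply: mem_part uk _.
by rewrite (side_compl tij) inE.
Qed.

Definition bag_np F := forall H H', H \in F -> H' \in F -> connected_in (shares B) (H :\: H').

(** Vertices of [H :\: H'] on both sides would be joined inside this connected difference, which
    avoids the adhesion because the traces agree. *)
Lemma np_pair F i j H H' : bag_np F -> tadj T i j -> H \in F -> H' \in F ->
  H :&: adh i j = H' :&: adh i j ->
  H :&: part i j \subset H' \/ H :&: part j i \subset H'.
Proof.
move=> npF tij HF HF' e.
have [|/subsetPn[x /setIP[xH xp] xH']] := boolP (H :&: part i j \subset H'); first by left.
have [|/subsetPn[y /setIP[yH yp] yH']] := boolP (H :&: part j i \subset H'); first by right.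
case: (separated tij (npF _ _ HF HF') _ _ _ xp yp); rewrite ?inE ?xH ?yH ?xH' ?yH' //.
move=> z /setDP[zH zH'] za; have : z \in H' :&: adh i j by rewrite -e inE zH za.
by rewrite inE (negPf zH').
Qed.

(** Incomparability excludes the first alternative of [np_pair] in both orders, so the second one
    gives both inclusions on the far side. *)
Lemma np_incomparable F i j H H' : bag_np F -> tadj T i j -> H \in F -> H' \in F ->
  H :&: adh i j = H' :&: adh i j ->
  ~~ (H :&: part i j \subset H') -> ~~ (H' :&: part i j \subset H) ->
  H :&: part j i = H' :&: part j i.
Proof.
move=> npF tij HF HF' e n1 n2.
case: (np_pair npF tij HF HF' e); first by rewrite (negPf n1).
case: (np_pair npF tij HF' HF (esym e)); first by rewrite (negPf n2).
move=> s1 s2; apply/eqP; rewrite eqEsubset !subsetI s1 s2 /=.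
by rewrite !subsetIr.
Qed.

End Bags.

(** The arcs of the tree path are crossed one at a time; at each, an element of [X] common to both
    end bags prolongs the walk inside [X]. *)
Lemma towards_chain N (T : btree N) (Z : finType) (C : 'I_N.+1 -> {set Z}) (X : {set Z}) i0 j0 z :
  z \in X -> z \in C i0 ->
  (forall k k', towards T i0 j0 k k' -> exists y, [/\ y \in X, y \in C k & y \in C k']) ->
  exists z', [/\ z' \in X, z' \in C j0 & connect (induced (shares C) X) z z'].
Proof.
move=> zX zC h; have /connectP[s] := connect_towards T i0 j0; move: zX zC.
have gen i y : y \in X -> y \in C i -> path (towards T i0 j0) i s -> j0 = last i s ->
    exists z', [/\ z' \in X, z' \in C j0 & connect (induced (shares C) X) y z'].
  elim: s i y => [|k s IHs] i y yX yC /=; first by move=> _ ->; exists y; split=> //; apply: connect0.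
  case/andP=> tik pk ej; have [x [xX xi xk]] := h _ _ tik.
  have [z' [zX' zC' c']] := IHs k x xX xk pk ej.
  exists z'; split=> //; apply: connect_trans (connect1 _) c'.
  by rewrite /induced /= xX yX !andbT; apply/existsP; exists i; rewrite yC xi.
exact: gen.
Qed.

(** * Carrying selected elements along the arcs *)

Section Propagation.
Variables (N : nat) (T : btree N) (V : finType) (B : 'I_N.+1 -> {set V}).
Local Notation I := 'I_N.+1.
Variables (Z : finType) (Loc : I -> {set Z}).
Variable sel : I -> I -> {set V} -> {set Z} -> option Z.
Hypothesis sel_in : forall i j P C z, sel i j P C = Some z -> z \in C.

Definition picks i j (C : {set Z}) : {set Z} :=
  [set z | [exists P in powerset (adh T B i j), sel i j P C == Some z]].

(** The recursion runs backwards over arcs, so [n] is fuel; by [carriedE] the number of nodes is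
    enough. *)
Fixpoint carried_upto n i j : {set Z} :=
  if n is n'.+1 then
    picks i j (Loc i :|: \bigcup_(c | tadj T c i && (c != j)) carried_upto n' c i)
  else set0.

(* Elements selected for the arc [i -> j]: at most one per trace on the adhesion, each one local to [i] or carried by an arc entering [i]. *)
Definition carried i j := carried_upto #|I| i j.
Definition candidates i j := Loc i :|: \bigcup_(c | tadj T c i && (c != j)) carried c i.

Lemma carriedE i j : tadj T i j -> carried i j = picks i j (candidates i j).
Proof.
have st n k l : tadj T k l -> #|side T k l| <= n -> carried_upto n.+1 k l = carried_upto n k l.
  elim: n k l => [|n IHn] k l tkl.
    by rewrite leqn0 cards_eq0 => /eqP e; have := side_refl tkl; rewrite e inE.
  move=> le; rewrite [LHS]/= [RHS]/=; congr (picks _ _ (_ :|: _)).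
  apply: eq_bigr => c /andP[tck ncl]; apply: IHn => //.
  by rewrite -ltnS (leq_trans _ le) // side_card.
by move=> tij; rewrite /carried -st // max_card.
Qed.

Lemma carried_sub i j z : tadj T i j -> z \in carried i j -> z \in candidates i j.
Proof.
move=> tij; rewrite carriedE // inE => /existsP[P /andP[_ /eqP]]; exact: sel_in.
Qed.

Lemma candidatesP i j z : z \in candidates i j ->
  z \in Loc i \/ exists c, [/\ tadj T c i, c != j & z \in carried c i].
Proof.
case/setUP=> [|/bigcupP[c /andP[tci ncj] zc]]; first by left.
by right; exists c.
Qed.

Lemma Loc_candidates i j z : z \in Loc i -> z \in candidates i j.
Proof. by rewrite in_setU => ->. Qed.

Lemma carried_candidates i j c z : tadj T c i -> c != j -> z \in carried c i ->
  z \in candidates i j.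
Proof.
by move=> tci ncj zc; rewrite in_setU; apply/orP; right; apply/bigcupP; exists c; rewrite // tci.
Qed.

Lemma mem_carried i j (P : {set V}) z : tadj T i j -> P \subset adh T B i j ->
  sel i j P (candidates i j) = Some z -> z \in carried i j.
Proof.
move=> tij Pa ez; rewrite carriedE // inE; apply/existsP; exists P.
by rewrite powersetE Pa ez eqxx.
Qed.

Definition spread z : {set I} :=
  [set i | (z \in Loc i) || [exists j, tadj T i j && ((z \in carried i j) || (z \in carried j i))]].
Definition sbag i : {set Z} := [set z | i \in spread z].

Lemma Loc_sbag i : Loc i \subset sbag i.
Proof. by apply/subsetP=> z zi; rewrite !inE zi. Qed.

Lemma carried_sbag i j z : tadj T i j -> z \in carried i j -> z \in sbag i /\ z \in sbag j.
Proof.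
move=> tij zc; rewrite !inE; split; apply/orP; right; apply/existsP.
  by exists j; rewrite tij zc.
by exists i; rewrite tadj_sym tij zc orbT.
Qed.

(** A carried element is local at the tail of its arc or was carried into that tail. Tracing it back
    stays inside the spread and ends at a node where it is local. *)
Lemma spread_connected z :
  connected_in (tadj T) [set i | z \in Loc i] -> connected_in (tadj T) (spread z).
Proof.
move=> cL; pose g := induced (tadj T) (spread z).
have gs : symmetric g.
  by move=> x y; rewrite /g /induced /= tadj_sym [(x \in _) && _]andbC.
have LL i j : z \in Loc i -> z \in Loc j -> connect g i j.
  move=> zi zj; have := cL i j; rewrite !inE => /(_ zi zj).
  apply: connect_homo_gen => a b /and3P[tab]; rewrite !inE => za zb.
  by apply: connect1; rewrite /g /induced /= tab !inE za zb.
have link i j : tadj T i j -> z \in carried i j -> connect g i j.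
  move=> tij zc; have [] := carried_sbag tij zc; rewrite !(inE, in_set) => zi zj.
  by apply: connect1; rewrite /g /induced /= tij !inE zi zj.
have root : forall i j, tadj T i j -> z \in carried i j -> exists2 l, z \in Loc l & connect g l i.
  apply: arc_ind => i j tij IH zc.
  have [zi|[c [tci ncj zci]]] := candidatesP (carried_sub tij zc); first by exists i.
  have [l zl cl] := IH c tci ncj zci; exists l => //.
  exact: connect_trans cl (link _ _ tci zci).
have rootx i : i \in spread z -> exists2 l, z \in Loc l & connect g l i.
  rewrite inE => /orP[zi|/existsP[j /andP[tij /orP[zc|zc]]]]; first by exists i.
    exact: root zc.
  rewrite tadj_sym in tij; have [l zl cl] := root _ _ tij zc; exists l => //.
  exact: connect_trans cl (link _ _ tij zc).
move=> i j /rootx[l zl cl] /rootx[l' zl' cl'].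
apply: connect_trans (connect_trans _ (LL _ _ zl zl')) cl'.
by rewrite (sym_connect_sym gs).
Qed.

Lemma carried_card n i j : coherent T B -> tadj T i j -> #|B i| <= n -> #|carried i j| <= 2 ^ n.
Proof.
move=> cohB tij Bn; rewrite carriedE //.
pose f P := sel i j P (candidates i j).
have -> : #|picks i j (candidates i j)| = #|Some @: picks i j (candidates i j)|.
  by rewrite card_imset // => x y [].
apply: leq_trans (_ : #|f @: powerset (adh T B i j)| <= _).
  apply: subset_leq_card; apply/subsetP=> _ /imsetP[z zp ->].
  move: zp; rewrite inE => /existsP[P /andP[Pa /eqP <-]].
  exact: imset_f.
apply: leq_trans (leq_imset_card _ _) _; rewrite card_powerset leq_exp2l //.
exact: leq_trans (subset_leq_card (adh_bag cohB tij)) Bn.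
Qed.

(** The factor [6] is three neighbours times two directions; each arc carries at most one element
    per subset of its adhesion, which lies in a bag. *)
Lemma sbag_card n i : coherent T B -> (forall i, #|B i| <= n) ->
  #|sbag i| <= #|Loc i| + 6 * 2 ^ n.
Proof.
move=> cohB Bn; pose nb := [set j | tadj T i j].
have sub : sbag i \subset Loc i :|: \bigcup_(j in nb) (carried i j :|: carried j i).
  apply/subsetP=> z; rewrite !inE => /orP[->//|/existsP[j /andP[tij zc]]].
  apply/orP; right; apply/bigcupP; exists j; rewrite inE //.
apply: leq_trans (subset_leq_card sub) _; apply: leq_trans (leq_card_setU _ _) _.
rewrite leq_add2l; apply: leq_trans (_ : \sum_(j in nb) 2 * 2 ^ n <= _).
  elim/big_rec2: _ => [|j m A]; first by rewrite cards0.
  rewrite inE => tij le; apply: leq_trans (leq_card_setU _ _) _; apply: leq_add le.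
  apply: leq_trans (leq_card_setU _ _) _; rewrite mul2n -addnn; apply: leq_add.
    exact: carried_card.
  by apply: carried_card => //; rewrite tadj_sym.
rewrite sum_nat_const mulnA leq_mul2r; apply/orP; right.
exact: (leq_mul (tadj_degree T i) (leqnn 2)).
Qed.

End Propagation.

(** * Making the sets [K :&: S] connected *)

Section Primal.
Variables (N : nat) (T : btree N) (V : finType) (B : 'I_N.+1 -> {set V}).
Variables (Ks : {set {set V}}) (S : {set V}).
Local Notation I := 'I_N.+1.
Local Notation part := (part T B).
Local Notation adh := (adh T B).
Implicit Types (i j k c d : I) (K L P : {set V}).
Hypothesis cohB : coherent T B.
Hypothesis covB : forall v, exists i, v \in B i.
Hypothesis npK : bag_np B Ks.

Definition crosses i j P K :=
  [&& K \in Ks, K :&: adh i j == P, K :&: S :&: part i j != set0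
    & K :&: S :&: part j i != set0].

(** A lexicographic key: the size of the near part comes first, and ties are broken by [enum_rank],
    which is below [#|{set V}|]. Distinct sets have distinct keys, so the least member is unique. *)
Definition key i j K := #|K :&: part i j| * #|{set V}| + enum_rank K.

Definition least i j P L :=
  crosses i j P L && [forall K, crosses i j P K ==> (key i j L <= key i j K)].

Lemma leastP i j P L : least i j P L ->
  crosses i j P L /\ forall K, crosses i j P K -> key i j L <= key i j K.
Proof. by case/andP=> -> /forallP h; split=> // K; apply/implyP. Qed.

Lemma crosses_sym i j P K : crosses i j P K -> crosses j i P K.
Proof. by rewrite /crosses adhC; case/and4P=> -> -> -> ->. Qed.

Lemma least_exists i j P K : crosses i j P K -> exists L, least i j P L.
Proof.
move=> cK; case: (arg_minnP (key i j) cK) => L cL min; exists L.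
by rewrite /least cL; apply/forallP=> K'; apply/implyP; apply: min.
Qed.

Lemma key_proper i j K L : K :&: part i j \proper L :&: part i j -> key i j K < key i j L.
Proof.
move/proper_card=> lt; rewrite /key.
apply: leq_trans (_ : #|K :&: part i j|.+1 * #|{set V}| <= _).
  by rewrite mulSn [X in _ <= X]addnC ltn_add2l; have := ltn_ord (enum_rank K).
by rewrite (leq_trans (leq_mul lt (leqnn _))) // leq_addr.
Qed.

(** If the near part of [K] were inside [L], it would be a proper part of that of [L] and give [K] a
    smaller key. *)
Lemma least_incomparable i j P L K : least i j P L -> crosses i j P K ->
  ~~ (L :&: part i j \subset K) -> ~~ (K :&: part i j \subset L).
Proof.
move=> /leastP[_ min] cK nLK; apply/negP=> sKL; have := min K cK.
rewrite leqNgt key_proper // properE !subsetI sKL !subsetIr /= andbT.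
by apply: contra nLK => ->.
Qed.

Lemma crosses_pred i j c P L : tadj T i j -> tadj T c i -> c != j ->
  crosses i j P L -> L :&: S :&: part c i != set0 -> crosses c i (L :&: adh c i) L.
Proof.
move=> tij tci ncj /and4P[LK _ _ /set0Pn[z zL]] Lc; rewrite /crosses LK eqxx Lc /=.
apply/set0Pn; exists z; case/setIP: zL => zLS zji; rewrite in_setI zLS /=.
exact: (subsetP (part_sub _ (side_subC tij tci ncj))) zji.
Qed.

(** Otherwise [L] and [L'] are incomparable behind [c], hence equal beyond it, so [L'] crosses
    [i -> j] with trace [P] too. Passing from one arc to the other changes both keys by the same
    amount, and the two minimality conditions force [L = L']. *)
Lemma least_pred i j c P L L' : tadj T i j -> tadj T c i -> c != j ->
  least i j P L -> crosses c i (L :&: adh c i) L -> least c i (L :&: adh c i) L' ->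
  L' :&: part c i \subset L.
Proof.
move=> tij tci ncj lL cL lL'; apply/negPn/negP=> nLL.
have [/and4P[LK /eqP eP L1 L2] minL] := leastP lL.
have [/and4P[LK' /eqP eP' L1' L2'] minL'] := leastP lL'.
have s1 : part j i \subset part i c by apply: part_sub; apply: side_subC.
have s2 : part c i \subset part i j by apply: part_sub; apply: side_sub.
have nLL' := least_incomparable lL' cL nLL.
have eU : L' :&: part i c = L :&: part i c by apply: (np_incomparable npK tci LK' LK eP' nLL).
have memU z : z \in part i c -> (z \in L') = (z \in L).
  by move=> zc; move/setP/(_ z): eU; rewrite !inE zc !andbT.
have cL' : crosses i j P L'.
  rewrite /crosses LK' -eP /=; apply/and3P; split.
  - apply/eqP/setP=> z; rewrite !in_setI; case: (boolP (z \in part j i)) => [zji|_].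
      by rewrite memU // (subsetP s1).
    by rewrite !andbF.
  - have /set0Pn[z] := L1'; rewrite in_setI => /andP[zLS zc].
    by apply/set0Pn; exists z; rewrite in_setI zLS (subsetP s2).
  - have /set0Pn[z] := L2; rewrite in_setI => /andP[]; rewrite in_setI => /andP[zL zS] zc.
    by apply/set0Pn; exists z; rewrite in_setI zc andbT in_setI zS memU ?zL // (subsetP s1).
have splitc X : #|X :&: part i j| = #|X :&: part c i| + #|X :&: (part i j :\: part c i)|.
  rewrite -(cardsID (part c i) (X :&: part i j)); congr (_ + _); apply: eq_card => z.
    rewrite !in_setI; case: (boolP (z \in part c i)) => [/(subsetP s2)->|]; last by rewrite !andbF.
    by rewrite !andbT.
  by rewrite !(in_setI, in_setD) andbCA.
(* This remainder lies in [part i c], where [L] and [L'] coincide. *)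
have eD : #|L' :&: (part i j :\: part c i)| = #|L :&: (part i j :\: part c i)|.
  apply: eq_card => z; rewrite !(in_setI, in_setD).
  case: (boolP (z \in part c i)) => [|zc]; first by rewrite !andbF.
  rewrite memU //; have [k zk] := covB z.
  by case: (part_cover tci zk) => //; rewrite (negPf zc).
have := minL _ cL'; have := minL' _ cL; rewrite /key !splitc eD.
set a := #|L :&: part c i|; set a' := #|L' :&: part c i|; set M := #|{set V}|; set d := #|_|.
move=> le1 le2; have e : a * M + enum_rank L = a' * M + enum_rank L'.
  by apply/eqP; rewrite eqn_leq le1 andbT -(leq_add2l (d * M)) !addnA -!mulnDl ![d + _]addnC.
(* Modulo [M] both keys reduce to the ranks. *)
have : enum_rank L = enum_rank L' :> nat.
  have := congr1 (modn^~ M) e; rewrite !modnMDl !modn_small //; exact: ltn_ord.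
move/val_inj/enum_rank_inj=> eL; by rewrite eL subsetIl in nLL.
Qed.

Definition psel i j P (C : {set V}) : option V :=
  [pick z | (z \in C) && [exists L, least i j P L && (z \in L :&: S :&: part i j)]].

Lemma psel_in i j P C z : psel i j P C = Some z -> z \in C.
Proof. by rewrite /psel; case: pickP => // x /andP[xC _] [<-]. Qed.

Definition plocal i := B i :&: S.
Local Notation carriedP := (carried T B plocal psel).

(** The least member [L] has a vertex of [S] behind the arc. In the bag of [i] it is local;
    otherwise [L] crosses an arc entering [i], and [least_pred] puts the vertex carried there into
    [L]. *)
Lemma carried_least i j P : tadj T i j -> forall K, crosses i j P K ->
  exists z L, [/\ z \in carriedP i j, least i j P L, z \in L, z \in S & z \in part i j].
Proof.
move=> tij; elim/arc_ind: i j / tij P => i j tij IH P K cK.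
have [L lL] := least_exists cK; have [cL _] := leastP lL.
suff [z zC zL] : exists2 z, z \in candidates T B plocal psel i j & z \in L :&: S :&: part i j.
  case e : (psel i j P (candidates T B plocal psel i j)) => [x|].
    exists x; have xc : x \in carriedP i j.
      apply: (mem_carried tij _ e); have /and4P[_ /eqP <- _ _] := cL; exact: subsetIr.
    move: e; rewrite /psel; case: pickP => // y /andP[_ /existsP[L' /andP[lL' yL']]] [exy].
    exists L'; rewrite -exy; move: yL'; rewrite !in_setI => /andP[/andP[-> ->] ->].
    by rewrite exy.
  move: e; rewrite /psel; case: pickP => // /(_ z); rewrite zC /=.
  by move/existsP; case; exists L; rewrite lL.
have /and4P[_ _ /set0Pn[v vL] _] := cL.
move: (vL); rewrite in_setI => /andP[vLS /bigcupP[k kij vk]].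
have [eki|nki] := eqVneq k i.
  exists v => //; apply: Loc_candidates; rewrite in_setI -{1}eki vk /=.
  by move: vLS; rewrite in_setI => /andP[].
have [c [tci ncj kci]] := side_next tij kij nki.
have cLc : crosses c i (L :&: adh c i) L.
  apply: (crosses_pred tij) => //; first exact: cL.
  by apply/set0Pn; exists v; rewrite in_setI vLS (mem_part vk kci).
have [z [L' [zc lL' zL' zS zp]]] := IH c tci ncj _ _ cLc.
exists z; first exact: carried_candidates zc.
have sub := least_pred tij tci ncj lL cLc lL'.
rewrite !in_setI zS andbT (subsetP sub) ?in_setI ?zL' //=.
exact: (subsetP (part_sub _ (side_sub tij tci ncj))) zp.
Qed.

(** Suppose [x] in [L] and [y] in [M], carried in the two directions, both miss [K]. Then [L] agrees
    with [K] on [part j i] and [M] agrees with [K] on [part i j]. Hence [L] and [M] are incomparable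
    on [part i j], so they agree on [part j i], and [y] lies in [K] after all. *)
Lemma carried_hits i j P K : tadj T i j -> crosses i j P K ->
  exists z, [/\ z \in K, z \in S, z \in sbag T B plocal psel i & z \in sbag T B plocal psel j].
Proof.
move=> tij cK; have tji : tadj T j i by rewrite tadj_sym.
have [x [L [xc lL xL xS xp]]] := carried_least tij cK.
have [y [M [yc lM yM yS yp]]] := carried_least tji (crosses_sym cK).
have [xK|xK] := boolP (x \in K); first by exists x; have [] := carried_sbag tij xc.
have [yK|yK] := boolP (y \in K); first by exists y; have [] := carried_sbag tji yc.
have [cL _] := leastP lL; have [cM _] := leastP lM.
have /and4P[LK /eqP tL _ _] := cL; have /and4P[MK /eqP tM _ _] := cM.
have /and4P[KK /eqP tK _ _] := cK; rewrite adhC in tM.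
have nLK : ~~ (L :&: part i j \subset K).
  by apply: contra xK => /subsetP; apply; rewrite in_setI xL.
have nMK : ~~ (M :&: part j i \subset K).
  by apply: contra yK => /subsetP; apply; rewrite in_setI yM.
have nKL := least_incomparable lL cK nLK.
have nKM := least_incomparable lM (crosses_sym cK) nMK.
have e1 : L :&: part j i = K :&: part j i.
  by apply: (np_incomparable npK tij) => //; rewrite tL tK.
have e2 : M :&: part i j = K :&: part i j.
  by apply: (np_incomparable npK tji) => //; rewrite adhC tM tK.
have e3 : L :&: part j i = M :&: part j i.
  apply: (np_incomparable npK tij) => //; first by rewrite tL tM.
    apply: contra nLK => s; have : L :&: part i j \subset M :&: part i j by rewrite subsetI s subsetIr.
    by rewrite e2 subsetI => /andP[].
  by rewrite e2.
by move: nMK; rewrite -e3 e1 subsetIl.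
Qed.

Lemma primal_bags n : (forall i, #|B i| <= n) ->
  exists B' : I -> {set V}, [/\ coherent T B', forall i, B i :&: S \subset B' i,
    forall i, #|B' i| <= n + 6 * 2 ^ n & forall K, K \in Ks -> connected_in (shares B') (K :&: S)].
Proof.
move=> Bn; exists (sbag T B plocal psel); split.
- move=> v; have -> : [set i | v \in sbag T B plocal psel i] = spread T B plocal psel v.
    by apply/setP=> i; rewrite !inE.
  apply: (spread_connected psel_in); have [vS|vS] := boolP (v \in S).
    have -> : [set i | v \in plocal i] = [set i | v \in B i] by apply/setP=> i; rewrite !inE vS andbT.
    exact: cohB.
  by move=> i j; rewrite !inE (negPf vS) andbF.
- by move=> i; apply: Loc_sbag.
- move=> i; apply: leq_trans (sbag_card _ _ _ cohB Bn) _; rewrite leq_add2r.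
  exact: leq_trans (subset_leq_card (subsetIl _ _)) (Bn i).
move=> K KK x y xX yX; have [i xi] := covB x; have [j yj] := covB y.
have [xK xS] := setIP xX; have [yK yS] := setIP yX.
have xb : x \in sbag T B plocal psel i by apply: (subsetP (Loc_sbag _ _ _ _ _)); rewrite in_setI xi.
have yb : y \in sbag T B plocal psel j by apply: (subsetP (Loc_sbag _ _ _ _ _)); rewrite in_setI yj.
(* [K] crosses every arc between a bag of [x] and a bag of [y], with [x] and [y] as witnesses, so
   [carried_hits] provides the links. *)
have [k k' /and3P[tkk ik jk]|z [zX zj cz]] := towards_chain (T := T) (j0 := j) xX xb.
  have [|z [zK zS z1 z2]] := @carried_hits k k' (K :&: adh k k') K tkk.
    rewrite /crosses KK eqxx /=; apply/andP; split; apply/set0Pn.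
      by exists x; rewrite in_setI xX (mem_part xi ik).
    by exists y; rewrite in_setI yX (mem_part yj jk).
  by exists z; rewrite in_setI zK zS.
apply: connect_trans cz (connect1 _); rewrite /induced /= zX yX !andbT.
by apply/existsP; exists j; rewrite zj yb.
Qed.
End Primal.

(** * Comparing two sets on a region *)

Section Comparison.
Variable V : finType.
Implicit Types (D H X Y : {set V}) (F G : {set {set V}}).

Definition agree D H X := H :&: D == X :&: D.
Definition exceeds D H X := ~~ (H :&: D \subset X).
Definition incomp D H X := exceeds D H X && exceeds D X H.
Definition smaller D H X := ~~ exceeds D H X && exceeds D X H.

Lemma agreeP D H X : reflect (forall v, v \in D -> (v \in H) = (v \in X)) (agree D H X).
Proof.
apply: (iffP eqP) => [/setP e v vD|e]; first by have := e v; rewrite !inE vD !andbT.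
by apply/setP=> v; rewrite !inE; case: (boolP (v \in D)) => [/e->//|]; rewrite !andbF.
Qed.

Lemma exceedsP D H X : reflect (exists v, [/\ v \in D, v \in H & v \notin X]) (exceeds D H X).
Proof.
apply: (iffP subsetPn) => [[v /setIP[vH vD] vX]|[v [vD vH vX]]]; exists v => //.
by rewrite inE vH.
Qed.

Lemma agree_sym D H X : agree D H X = agree D X H. Proof. exact: eq_sym. Qed.

Lemma agree_trans D H X Y : agree D H X -> agree D X Y -> agree D H Y.
Proof. by move=> /eqP e /eqP e'; rewrite /agree e e'. Qed.

Lemma agree_sub D' D H X : D' \subset D -> agree D H X -> agree D' H X.
Proof. by move=> /subsetP s /agreeP e; apply/agreeP=> v /s; apply: e. Qed.

Lemma exceeds_sub D' D H X : D' \subset D -> exceeds D' H X -> exceeds D H X.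
Proof. by move=> /subsetP s /exceedsP[v [/s vD vH vX]]; apply/exceedsP; exists v. Qed.

Lemma exceeds_agreel D H Y X : agree D H Y -> exceeds D H X = exceeds D Y X.
Proof. by move/eqP=> e; rewrite /exceeds e. Qed.

Lemma exceeds_agreer D H Y X : agree D H Y -> exceeds D X H = exceeds D X Y.
Proof.
move=> /agreeP e; apply/exceedsP/exceedsP=> -[v [vD vX vH]]; exists v; split=> //.
  by rewrite -e.
by rewrite e.
Qed.

Lemma exceedsPn D H X : ~~ exceeds D H X -> forall v, v \in D -> v \in H -> v \in X.
Proof.
by move=> n v vD vH; apply: contraNT n => vX; apply/exceedsP; exists v.
Qed.

Lemma agreeE D H X : agree D H X = ~~ exceeds D H X && ~~ exceeds D X H.
Proof.
apply/idP/andP=> [e|[n1 n2]].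
  by rewrite (exceeds_agreel _ e) [exceeds D X H](exceeds_agreer _ e) /exceeds !negbK subsetIl.
apply/agreeP=> v vD; apply/idP/idP; first exact: exceedsPn vD.
exact: exceedsPn vD.
Qed.

(** With [b] true, [H] is a largest member of [F] on [D]; with [b] false, a smallest one. *)
Definition extremal (b : bool) F D H :=
  [forall X in F, ~~ (if b then exceeds D X H else exceeds D H X)].

Lemma extremalP b F D H X : extremal b F D H -> X \in F ->
  ~~ (if b then exceeds D X H else exceeds D H X).
Proof. by move/forall_inP; apply. Qed.

Lemma extremal_agree b F D H X : H \in F -> X \in F -> extremal b F D H -> extremal b F D X ->
  agree D H X.
Proof.
move=> HF XF /extremalP/(_ XF) h1 /extremalP/(_ HF) h2.
by rewrite agreeE; case: b h1 h2 => -> ->.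
Qed.

(** [F] is a chain on each region, and no member exceeds another on both. Members of [G] extremal on
    both regions get four codes. Any other is either smallest on [D2] or largest on [D1] without
    being so, and each of these two classes has at most one element. *)
Lemma card_extremal_le6 F G D1 D2 : G \subset F ->
  {in F &, forall H X, ~~ incomp D1 H X} -> {in F &, forall H X, ~~ incomp D2 H X} ->
  {in F &, forall H X, exceeds D1 H X -> exceeds D2 H X -> False} ->
  {in F &, forall H X, agree D1 H X -> agree D2 H X -> H = X} ->
  {in G, forall H, (exists b, extremal b F D1 H) \/
     exists X, [/\ X \in F, agree D1 H X & smaller D2 H X]} ->
  {in G, forall H, (exists b, extremal b F D2 H) \/
     exists Y, [/\ Y \in F, agree D2 H Y & smaller D1 Y H]} ->
  #|G| <= 6.
Proof.
move=> /subsetP GF i1 i2 two inj g1 g2.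
pose f H : bool * bool + bool :=
  if [pick ab : bool * bool | extremal ab.1 F D1 H && extremal ab.2 F D2 H] is Some ab
  then inl ab else inr (extremal false F D2 H).
suff fi : {in G &, injective f}.
  by rewrite -(card_in_imset fi) (leq_trans (max_card _)) // card_sum card_prod card_bool.
have case2 H : H \in G -> (forall ab : bool * bool, extremal ab.1 F D1 H && extremal ab.2 F D2 H = false) ->
    if extremal false F D2 H then exists X, [/\ X \in F, agree D1 H X & exceeds D2 X H]
    else extremal true F D1 H /\ exists Y, [/\ Y \in F, agree D2 H Y & exceeds D1 H Y].
  move=> HG no; have HF := GF _ HG; case: ifPn => m2.
    case: (g1 H HG) => [[b eb]|[X [XF aX /andP[_ sX]]]]; last by exists X.
    by have := no (b, false); rewrite /= eb m2.
  case: (g1 H HG) => [[b eb]|[X [XF aX /andP[nX sX]]]].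
    case: (g2 H HG) => [[b' eb']|[Y [YF aY /andP[_ sY]]]].
      by have := no (b, b'); rewrite /= eb eb'.
    split; last by exists Y.
    case: b eb => // /extremalP/(_ YF); by rewrite sY.
  case: (g2 H HG) => [[[] eb']|[Y [YF aY /andP[_ sY]]]].
  - by have := extremalP eb' XF; rewrite sX.
  - by rewrite eb' in m2.
  (* [X] equals [H] on [D1] and [Y] equals [H] on [D2], so [X] would exceed [Y] on both regions. *)
  case: (two X Y XF YF); first by rewrite -(exceeds_agreel _ aX).
  by rewrite -(exceeds_agreer _ aY).
move=> H H' HG HG'; have HF := GF _ HG; have HF' := GF _ HG'; rewrite /f.
case: pickP => [ab /andP[e1 e2]|/case2-/(_ HG) c2]; last first.
  case: pickP => // /case2-/(_ HG') c2' [em]; move: c2 c2'; rewrite -em.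
  have sub2 A A' : A \in F -> A' \in F -> agree D2 A A' ->
      (exists X, [/\ X \in F, agree D1 A X & exceeds D2 X A]) -> ~~ exceeds D1 A A'.
    move=> AF AF' aA [X [XF aX sX]]; apply/negP=> ex; case: (two X A' XF AF').
      by rewrite -(exceeds_agreel _ aX).
    by rewrite -(exceeds_agreer _ aA).
  have sub1 A A' : A \in F -> A' \in F -> agree D1 A A' ->
      (exists Y, [/\ Y \in F, agree D2 A Y & exceeds D1 A Y]) -> ~~ exceeds D2 A' A.
    move=> AF AF' aA [Y [YF aY sY]]; apply/negP=> ex; case: (two A' Y AF' YF).
      by rewrite -(exceeds_agreel _ aA).
    by rewrite -(exceeds_agreer _ aY).
  case: ifP => [m2 hX hX'|_ [mx hY] [mx' hY']].
    have m2' : extremal false F D2 H' by rewrite -em.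
    have a2 := extremal_agree HF HF' m2 m2'; apply: inj => //.
    by rewrite agreeE (sub2 H H') // (sub2 H' H) // agree_sym.
  have a1 := extremal_agree HF HF' mx mx'; apply: inj => //.
  by rewrite agreeE (sub1 H H') // (sub1 H' H) // agree_sym.
case: pickP => [ab' /andP[e1' e2'] [eab]|//]; rewrite -eab in e1' e2'.
by apply: inj => //; [apply: extremal_agree e1 e1' | apply: extremal_agree e2 e2'].
Qed.

End Comparison.

(** * Homes *)

Section Homes.
Variables (N : nat) (T : btree N) (V : finType) (B : 'I_N.+1 -> {set V}).
Variable Hs : {set {set V}}.
Local Notation I := 'I_N.+1.
Implicit Types (i j k c d q : I) (H X Y : {set V}) (W : {set {set V}}).
Hypothesis cohB : coherent T B.
Hypothesis npH : bag_np B Hs.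
Hypothesis connH : forall H, H \in Hs -> connected_in (shares B) H.
Hypothesis covH : forall H v, H \in Hs -> v \in H -> exists i, v \in B i.

(** * The regions below and above a node *)

Definition below c := \bigcup_(k in desc T c) B k.
Definition above c := \bigcup_(k in ~: desc T c) B k.
Definition seam c := below c :&: above c.

Lemma part_up c : c != ord0 -> part T B c (par T c) = below c.
Proof. by move=> c0; rewrite /part side_up. Qed.

Lemma part_down c : c != ord0 -> part T B (par T c) c = above c.
Proof. by move=> c0; rewrite /part side_down. Qed.

Lemma adh_up c : c != ord0 -> adh T B c (par T c) = seam c.
Proof. by move=> c0; rewrite /adh part_up // part_down. Qed.

Lemma above_root : above ord0 = set0.
Proof.
apply/setP=> v; rewrite inE; apply/bigcupP=> -[k]; by rewrite inE desc_root.
Qed.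

Lemma seam_par c : c != ord0 -> seam c \subset B (par T c).
Proof. by move=> c0; rewrite -adh_up // adh_bagr // tadj_par. Qed.

Lemma seam_bag c : seam c \subset B c.
Proof.
have [->|c0] := eqVneq c ord0; first by rewrite /seam above_root setI0 sub0set.
by rewrite -adh_up // adh_bag // tadj_par.
Qed.

Lemma seam_below c : seam c \subset below c. Proof. exact: subsetIl. Qed.
Lemma seam_above c : seam c \subset above c. Proof. exact: subsetIr. Qed.

Lemma below_desc c d : c \in desc T d -> below c \subset below d.
Proof.
move=> cd; apply/subsetP=> v /bigcupP[k kc vk]; apply/bigcupP; exists k => //.
exact: desc_trans kc cd.
Qed.

Lemma above_desc c d : c \in desc T d -> above d \subset above c.
Proof.
move=> cd; apply/subsetP=> v /bigcupP[k kd vk]; apply/bigcupP; exists k => //.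
by move: kd; rewrite !in_setC; apply: contra => kc; apply: desc_trans kc cd.
Qed.

Lemma below_above c d : [disjoint desc T c & desc T d] -> below c \subset above d.
Proof.
move=> dis; apply/subsetP=> v /bigcupP[k kc vk]; apply/bigcupP; exists k => //.
by rewrite in_setC (disjointFr dis).
Qed.

Lemma bag_above c : c != ord0 -> B (par T c) \subset above c.
Proof.
by move=> c0; apply/subsetP=> v vc; apply/bigcupP; exists (par T c); rewrite // inE par_notin_desc.
Qed.

Lemma below_or_above c H v : H \in Hs -> v \in H -> v \in below c \/ v \in above c.
Proof.
move=> HH vH; have [k vk] := covH HH vH.
have [kc|kc] := boolP (k \in desc T c); first by left; apply/bigcupP; exists k.
by right; apply/bigcupP; exists k; rewrite // inE.
Qed.

Lemma below_child q v : v \in below q -> v \notin B q ->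
  exists d, [/\ d != ord0, par T d = q & v \in below d].
Proof.
case/bigcupP=> k kq vk vq; have nkq : k != q by apply: contraNneq vq => <-.
have [d [d0 ed kd]] := desc_child kq nkq; exists d; split=> //.
by apply/bigcupP; exists k.
Qed.

Lemma seam_separates c Y x y : connected_in (shares B) Y ->
  (forall z, z \in Y -> z \in seam c -> False) ->
  x \in Y -> y \in Y -> x \in below c -> y \in above c -> False.
Proof.
have [->|c0] := eqVneq c ord0; first by rewrite above_root inE.
move=> cY Yc xY yY xc yc; apply: (@separated _ T _ B c (par T c) Y x y) => //.
- exact: tadj_par.
- by rewrite adh_up.
- by rewrite part_up.
- by rewrite part_down.
Qed.

Lemma pair_below_above c H X : H \in Hs -> X \in Hs -> agree (seam c) H X ->
  exceeds (below c) H X -> exceeds (above c) H X -> False.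
Proof.
move=> HH XH /agreeP a /exceedsP[x [xc xH xX]] /exceedsP[y [yc yH yX]].
apply: (@seam_separates c (H :\: X) x y) => //; rewrite ?inE ?xX ?yX //; first exact: npH.
by move=> z; rewrite inE => /andP[zX zH] zc; rewrite -a ?zH in zX.
Qed.

Lemma incomp_below c H X : H \in Hs -> X \in Hs -> agree (seam c) H X ->
  incomp (below c) H X -> agree (above c) H X.
Proof.
move=> HH XH a /andP[e1 e2]; rewrite agreeE; apply/andP; split; apply/negP.
  exact: pair_below_above e1.
by apply: pair_below_above e2 => //; rewrite agree_sym.
Qed.

Lemma incomp_above c H X : H \in Hs -> X \in Hs -> agree (seam c) H X ->
  incomp (above c) H X -> agree (below c) H X.
Proof.
move=> HH XH a /andP[e1 e2]; rewrite agreeE; apply/andP; split; apply/negP=> e.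
  exact: pair_below_above e e1.
by apply: pair_below_above e e2 => //; rewrite agree_sym.
Qed.

(* [pushed_up H c]: another member with the same trace differs from [H] incomparably above [c], hence only above [c]. *)
Definition pushed_up H c := [exists X in Hs, agree (seam c) H X && incomp (above c) H X].
Definition pushed_down H c := [exists X in Hs, agree (seam c) H X && incomp (below c) H X].
(** The condition that forces the home of a nonempty [H] into the subtree of [c]. *)
Definition down H c := (H :&: above c == set0) || pushed_down H c.

Lemma incomp_agreer D H X X' : agree D X X' -> incomp D H X = incomp D H X'.
Proof. by move=> a; rewrite /incomp (exceeds_agreel _ a) (exceeds_agreer _ a). Qed.

Lemma incompxx D H : incomp D H H = false.
Proof. by rewrite /incomp /exceeds subsetIl. Qed.

Lemma incomp_sym D H X : incomp D H X = incomp D X H.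
Proof. exact: andbC. Qed.

(** If [X] pushes down and [Y] pushes up, then [X] agrees with [H] above and [Y] agrees with [H]
    below. So [X] and [Y] are incomparable below, hence agree above, and there [Y] agrees with
    [H]. *)
Lemma down_not_up H c : H \in Hs -> down H c -> ~~ pushed_up H c.
Proof.
move=> HH dn; apply/exists_inP=> -[Y YH /andP[aY iY]].
case/orP: dn => [/eqP H0|/exists_inP[X XH /andP[aX iX]]].
  by case/andP: iY => /exceedsP[v [vc vH _]] _; have := in_set0 v; rewrite -H0 inE vH vc.
have uX := incomp_below HH XH aX iX; have dY := incomp_above HH YH aY iY.
have aXY : agree (seam c) X Y by apply: agree_trans aY; rewrite agree_sym.
have iXY : incomp (below c) X Y by rewrite -(incomp_agreer _ dY) incomp_sym.
have uXY := incomp_below XH YH aXY iXY.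
by rewrite -(incomp_agreer _ (agree_trans uX uXY)) incompxx in iY.
Qed.

Lemma down_desc H c d : H \in Hs -> c \in desc T d -> down H c -> down H d.
Proof.
move=> HH cd /orP[/eqP H0|/exists_inP[X XH /andP[aX iX]]]; apply/orP; [left|right].
  by rewrite -subset0 -H0 setIS // above_desc.
have uX := agree_sub (above_desc cd) (incomp_below HH XH aX iX).
apply/exists_inP; exists X => //; rewrite (agree_sub (seam_above d) uX) /=.
by case/andP: iX => e1 e2; rewrite /incomp !(exceeds_sub (below_desc cd)).
Qed.

(** With [down_desc] this makes the nodes that force a nonempty [H] a chain from the root. If [X]
    pushes at [c] and [Y] at [d], then [Y] agrees with [H] below [c], hence with [X] and [H] above
    [c], which includes everything below [d]. *)
Lemma down_disjoint H c d : H \in Hs -> H != set0 -> [disjoint desc T c & desc T d] ->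
  down H c -> down H d -> False.
Proof.
move=> HH /set0Pn[v vH] dis.
have dis' : [disjoint desc T d & desc T c] by rewrite disjoint_sym.
have mixed a b : [disjoint desc T a & desc T b] -> H :&: above b = set0 -> ~~ pushed_down H a.
  move=> /below_above/subsetP s H0; apply/exists_inP=> -[X _ /andP[_ /andP[/exceedsP[x [xa xH _]] _]]].
  by have := in_set0 x; rewrite -H0 inE xH s.
case/orP=> [/eqP H0|pc] /orP[/eqP H1|pd].
- case: (below_or_above c HH vH) => vc; last by have := in_set0 v; rewrite -H0 inE vH vc.
  by have := in_set0 v; rewrite -H1 inE vH (subsetP (below_above dis)).
- by have := mixed d c dis' H0; rewrite pd.
- by have := mixed c d dis H1; rewrite pc.
case/exists_inP: pc => X XH /andP[aX iX]; case/exists_inP: pd => Y YH /andP[aY iY].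
have uX := incomp_below HH XH aX iX; have uY := incomp_below HH YH aY iY.
have cY := agree_sub (below_above dis) uY.
have aXY : agree (seam c) X Y.
  by apply: agree_trans (agree_sub (seam_below c) cY); rewrite agree_sym.
have iXY : incomp (below c) X Y by rewrite -(incomp_agreer _ cY) incomp_sym.
have uHY := agree_trans uX (incomp_below XH YH aXY iXY).
by rewrite -(incomp_agreer _ (agree_sub (below_above dis') uHY)) incompxx in iY.
Qed.

Lemma down_root H : down H ord0.
Proof. by rewrite /down above_root setI0 eqxx. Qed.

(* The deepest node towards which [H] is forced. *)
Definition start H := [arg max_(c > (ord0 : I) | down H c) (c : nat)].

Lemma startP H : down H (start H) /\ forall c, down H c -> c <= start H.
Proof. by rewrite /start; case: arg_maxnP => [|c dc mx]; [apply: down_root | split]. Qed.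

Lemma start_desc H c : H \in Hs -> H != set0 -> down H c -> start H \in desc T c.
Proof.
move=> HH H0 dc; have [ds mx] := startP H.
have [/pred0P dis|/pred0Pn[k /andP[ks kc]]] := boolP [disjoint desc T (start H) & desc T c].
  by case: (down_disjoint HH H0 _ ds dc); apply/pred0P.
case: (desc_linear ks kc) => // /desc_le le.
have -> : start H = c by apply/val_inj/eqP; rewrite eqn_leq le mx.
exact: desc_refl.
Qed.

(** * Moving members down the tree to their homes *)

Definition between W c H :=
  [exists X in W, agree (B (par T c)) H X && smaller (below c) H X] &&
  [exists X in W, agree (B (par T c)) H X && smaller (below c) X H].
(* Members that coincide below [c] are told apart by their part below the sibling of [c]; taking the largest on one side and the smallest on the other keeps staircases from piling up at [par T c]. *)
Definition tied W c H :=
  [exists X in W, [&& agree (B (par T c)) H X, agree (below c) H X &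
     if lab T c then smaller (below (par T c)) H X else smaller (below (par T c)) X H]].
Definition moves W c H := between W c H && ~~ tied W c H.

Definition start_at i := [set H in Hs | (H != set0) && (start H == i)].

Fixpoint visitors_upto n i : {set {set V}} :=
  if n is n'.+1 then
    start_at i :|: [set H in visitors_upto n' (par T i) |
                     (i != ord0) && moves (visitors_upto n' (par T i)) i H]
  else set0.

(** Parents have smaller indices, so fuel [N.+1] reaches the root from every node; [locked] prevents
    unwanted unfolding. *)
Definition visitors := locked (visitors_upto N.+1).

Lemma visitorsE i : visitors i =
  start_at i :|: [set H in visitors (par T i) | (i != ord0) && moves (visitors (par T i)) i H].
Proof.
pose step W k := start_at k :|: [set H in W | (k != ord0) && moves W k H].
have E n k : visitors_upto n.+1 k = step (visitors_upto n (par T k)) k by [].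
have st n k : k < n -> visitors_upto n.+1 k = visitors_upto n k.
  elim: n k => // n IHn k ltk; rewrite (E n.+1 k) (E n k); have [->|k0] := eqVneq k ord0.
    by apply/setP=> H; rewrite !inE !andbF.
  by rewrite IHn //; apply: leq_trans (par_lt (b := T) k0) ltk.
by rewrite /visitors -lock -[in LHS]st // E.
Qed.

Lemma visitorsP i H : H \in visitors i ->
  [/\ H \in Hs, H != set0 & start H = i] \/
  [/\ i != ord0, H \in visitors (par T i) & moves (visitors (par T i)) i H].
Proof.
rewrite visitorsE in_setU 2!in_set.
case/orP=> [/and3P[-> -> /eqP]|/and3P[-> -> ->]]; by [left | right].
Qed.

Lemma visitors_mem i H : H \in visitors i -> [/\ H \in Hs, H != set0 & i \in desc T (start H)].
Proof.
elim/(@node_ind _ T): i => i IHi /visitorsP[[-> -> <-]|[i0 Hq _]].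
  by rewrite desc_refl.
have [-> -> qs] := IHi i0 Hq; split=> //; exact: desc_par.
Qed.

(** Below [c], [X1] is strictly larger and [X2] strictly smaller than [H]; by [pair_below_above] the
    order is reversed above [c]. As [X1] and [X2] agree on the parent bag, so does everything
    between them. *)
Lemma between_sandwich W c H : c != ord0 -> W \subset Hs -> H \in Hs -> between W c H ->
  exists X1 X2, [/\ X1 \in W, X2 \in W, agree (B (par T c)) X1 X2 &
    forall X, X \in Hs -> agree (below c) H X ->
      [/\ agree (B (par T c)) H X, ~~ exceeds (above c) X1 X & ~~ exceeds (above c) X X2]].
Proof.
move=> c0 /subsetP WH HH /andP[/exists_inP[X1 X1W /andP[a1 /andP[_ s1]]]].
case/exists_inP=> X2 X2W /andP[a2 /andP[_ s2]].
have X1H := WH _ X1W; have X2H := WH _ X2W.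
have aq H1 H2 : agree (B (par T c)) H1 H2 -> agree (seam c) H1 H2 by apply: agree_sub; apply: seam_par.
exists X1, X2; split=> //; first by apply: agree_trans a2; rewrite agree_sym.
move=> X XH aX; have as_X : agree (seam c) H X by apply: agree_sub aX; apply: seam_below.
have n1 : ~~ exceeds (above c) X1 X.
  apply/negP=> e; apply: pair_below_above e => //.
    by apply: agree_trans as_X; rewrite agree_sym aq.
  by rewrite -(exceeds_agreer _ aX).
have n2 : ~~ exceeds (above c) X X2.
  apply/negP=> e; apply: pair_below_above e => //.
    by apply: (agree_trans _ (aq _ _ a2)); rewrite agree_sym.
  by rewrite -(exceeds_agreel _ aX).
split=> //; apply/agreeP=> v vq; have va := subsetP (bag_above c0) v vq.
move/agreeP: a1 => a1; move/agreeP: a2 => a2; apply/idP/idP=> vH.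
  by apply: (exceedsPn n1) => //; rewrite -a1.
by rewrite a2 //; apply: (exceedsPn n2).
Qed.

(** The first clause keeps a home out of subtrees from which the member is pushed up. The second
    makes visitors with equal bag traces comparable below each child, and the third identifies a
    visitor by its part below [i]; the counting of homes needs both. *)
Definition visitors_inv i :=
  [/\ forall H, H \in visitors i -> ~~ pushed_up H i,
      forall H c, H \in visitors i -> c != ord0 -> par T c = i -> ~~ down H c &
      {in visitors i &, forall H X, agree (below i) H X -> H = X}].

Lemma agree_eq c H X : H \in Hs -> X \in Hs -> agree (below c) H X -> agree (above c) H X -> H = X.
Proof.
move=> HH XH /agreeP ab /agreeP aa; apply/setP=> v; apply/idP/idP=> vH.
  by case: (below_or_above c HH vH) => [/ab<-|/aa<-].
by case: (below_or_above c XH vH) => [/ab->|/aa->].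
Qed.

Lemma visitors_invP i : visitors_inv i.
Proof.
elim/(@node_ind _ T): i => i IHi.
have nup_start H : H \in Hs -> start H = i -> ~~ pushed_up H i.
  by move=> HH es; apply: down_not_up => //; rewrite -es; case: (startP H).
(* If [H] has nothing above [i], connectedness keeps [X] below as well. Otherwise the set [Y]
   pushing [H] down is incomparable with [X] too, so both agree with [Y] above. *)
have inj_start H X : H \in Hs -> H != set0 -> start H = i -> X \in Hs ->
    agree (below i) H X -> H = X.
  move=> HH /set0Pn[v vH] es XH aHX; apply: (@agree_eq i) => //.
  have [] := startP H; rewrite es => /orP[/eqP H0|/exists_inP[Y YH /andP[aY iY]]] _; last first.
    have sY := incomp_below HH YH aY iY; apply: agree_trans sY _.
    apply: incomp_below => //; last by rewrite -(incomp_agreer _ aHX) incomp_sym.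
    by apply: agree_trans (agree_sub (seam_below i) aHX); rewrite agree_sym.
  have Hna w : w \in above i -> w \notin H.
    by move=> wa; apply/negP=> wH; have := in_set0 w; rewrite -H0 inE wH wa.
  have vb : v \in below i by case: (below_or_above i HH vH) => // /Hna; rewrite vH.
  move/agreeP: aHX => aHX; apply/agreeP=> w wa; rewrite (negPf (Hna w wa)).
  apply/esym/negP=> wX; apply: (@seam_separates i X v w) => //; first exact: connH.
    by move=> z zX /setIP[zb za]; have := Hna z za; rewrite aHX // zX.
  by rewrite -aHX.
have [i0|i0] := eqVneq i ord0.
  have vs H : H \in visitors i -> [/\ H \in Hs, H != set0 & start H = i].
    by case/visitorsP=> // -[]; rewrite i0 eqxx.
  split=> [H /vs[HH _ es]|H c /vs[HH _ es] c0 ec|H X /vs[HH H0 es] /vs[XH _ _]].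
  - exact: nup_start.
  - apply/negP=> /(startP H).2; rewrite es -ec leqNgt par_lt //.
  - exact: inj_start.
have [nup ndn inj] := IHi i0; set q := par T i in nup ndn inj *.
have vq H : H \in visitors q -> H \in Hs by case/visitors_mem.
have subW : visitors q \subset Hs by apply/subsetP.
split.
- move=> H /visitorsP[[HH _ es]|[_ Hq /andP[bt _]]]; first exact: nup_start.
  have HH := vq _ Hq; apply/exists_inP=> -[X XH /andP[aX iX]].
  have bX := incomp_above HH XH aX iX.
  have [X1 [X2 [X1W X2W a12 sw]]] := between_sandwich i0 subW HH bt.
  have [aq n1X n2X] := sw X XH bX.
  have [_ n1H n2H] : [/\ agree (B q) H H, ~~ exceeds (above i) X1 H & ~~ exceeds (above i) H X2].
    by apply: sw => //; apply: eqxx.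
  (* Both [y] and [x] lie in [X2 :\: X1], which is connected and misses the bag of [q]. So they are
     both above [q] or both below one child of [q], and either case contradicts the invariant at
     [q]. *)
  case/andP: iX => /exceedsP[y [yi yH yX]] /exceedsP[x [xi xX xH]].
  have yY : y \in X2 :\: X1.
    by rewrite inE (exceedsPn n2H) // andbT; apply: contra yX; apply: (exceedsPn n1X).
  have xY : x \in X2 :\: X1.
    by rewrite inE (exceedsPn n2X) // andbT; apply: contra xH; apply: (exceedsPn n1H).
  have YB z : z \in X2 :\: X1 -> z \in B q -> False.
    by rewrite inE => /andP[z1 z2] zq; move/agreeP/(_ z zq): a12; rewrite z2 (negPf z1).
  have cY : connected_in (shares B) (X2 :\: X1) by apply: npH; apply: vq.
  case: (below_or_above q HH yH) => yq; last first.
    have xq : x \in above q.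
      case: (below_or_above q XH xX) => // xb; exfalso.
      by apply: (seam_separates cY _ xY yY xb yq) => z zY /(subsetP (seam_bag q)); apply: YB.
    move/negP: (nup H Hq); apply; apply/exists_inP; exists X => //.
    rewrite (agree_sub (seam_bag q) aq) /incomp /=.
    by apply/andP; split; apply/exceedsP; [exists y | exists x].
  have [d [d0 ed yd]] : exists d, [/\ d != ord0, par T d = q & y \in below d].
    by apply: below_child yq _; apply/negP; apply: YB.
  have sd : seam d \subset B q by rewrite -ed seam_par.
  have xd : x \in below d.
    case: (below_or_above d XH xX) => // xa; exfalso.
    by apply: (seam_separates cY _ yY xY yd xa) => z zY /(subsetP sd); apply: YB.
  move/negP: (ndn H d Hq d0 ed); apply; apply/orP; right; apply/exists_inP; exists X => //.
  rewrite (agree_sub sd aq) /incomp /=.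
  by apply/andP; split; apply/exceedsP; [exists y | exists x].
- move=> H c /visitorsP[[HH _ es] c0 ec|[_ Hq _] c0 ec].
    by apply/negP=> /(startP H).2; rewrite es -ec leqNgt par_lt.
  apply: contra (ndn H i Hq i0 erefl) => dc.
  by apply: down_desc dc; [apply: vq | rewrite -ec child_desc].
move=> H X HV XV aHX.
have [HH _ _] := visitors_mem HV; have [XH X0 _] := visitors_mem XV.
case: (visitorsP HV) => [[_ H0 es]|[_ Hq mH]]; first exact: inj_start.
case: (visitorsP XV) => [[_ _ es]|[_ Xq mX]]; first by apply/esym/inj_start; rewrite // agree_sym.
have aq : agree (B q) H X.
  case/andP: mH => bt _; have [X1 [X2 [_ _ _ sw]]] := between_sandwich i0 subW HH bt.
  by case: (sw X XH aHX).
(* If one of two coinciding members were smaller below [q], the tie rule would stop one of them: the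
   smaller or the larger, according to the label of [i]. *)
have noless A A' : A \in visitors q -> A' \in visitors q -> moves (visitors q) i A ->
    moves (visitors q) i A' -> agree (B q) A A' -> agree (below i) A A' -> ~~ smaller (below q) A A'.
  move=> Aq Aq' /andP[_ tA] /andP[_ tA'] aA aB; apply/negP=> sm; case el : (lab T i).
    by move/negP: tA; apply; apply/exists_inP; exists A' => //; rewrite -/q aA aB el sm.
  move/negP: tA'; apply; apply/exists_inP; exists A => //.
  by rewrite -/q agree_sym aA agree_sym aB el sm.
apply: inj => //; have := noless X H Xq Hq mX mH; have := noless H X Hq Xq mH mX.
rewrite !(agree_sym _ X H) aq aHX => /(_ isT isT) n1 /(_ isT isT) n2.
rewrite agreeE; move: n1 n2; rewrite /smaller; case e1 : (exceeds _ H X); case e2 : (exceeds _ X H) => //= _ _.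
move/idP/exceedsP: e1 => [y [yq yH yX]]; move/idP/exceedsP: e2 => [x [xq xX xH]].
have [d [d0 ed yd]] : exists d, [/\ d != ord0, par T d = q & y \in below d].
  by apply: below_child yq _; apply/negP=> yq; move/agreeP/(_ y yq): aq; rewrite yH (negPf yX).
have [d' [d0' ed' xd]] : exists d, [/\ d != ord0, par T d = q & x \in below d].
  by apply: below_child xq _; apply/negP=> xq; move/agreeP/(_ x xq): aq; rewrite xX (negPf xH).
have ndi : d != i.
  apply/negP=> /eqP e; rewrite e in yd; move/agreeP/(_ y yd): aHX; by rewrite yH (negPf yX).
have ndi' : d' != i.
  apply/negP=> /eqP e; rewrite e in xd; move/agreeP/(_ x xd): aHX; by rewrite xX (negPf xH).
(* Both differ from [i], and [q] has at most two children. *)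
have edd : d = d'.
  apply: (lab_inj (b := T)) => //; first by rewrite ed ed'.
  apply/eqP; case: (boolP (lab T d == lab T d')) => // nl.
  have : lab T d != lab T i by apply: contraNneq ndi => el; apply/eqP; apply: lab_inj el.
  have : lab T d' != lab T i by apply: contraNneq ndi' => el; apply/eqP; apply: lab_inj el.
  by move: nl; case: (lab T d); case: (lab T d'); case: (lab T i).
have sd : seam d \subset B q by rewrite -ed seam_par.
move/negP: (ndn H d Hq d0 ed); case; apply/orP; right; apply/exists_inP; exists X => //.
rewrite (agree_sub sd aq) /incomp /=; rewrite -edd in xd.
by apply/andP; split; apply/exceedsP; [exists y | exists x].
Qed.

(** The empty set goes to the root by default. Any other member stops at the visited node of largest
    index, from which it moves to no child since children have larger indices. *)
Definition home H : I :=
  if H == set0 then ord0 else [arg max_(i > start H | H \in visitors i) (i : nat)].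

Lemma start_visitor H : H \in Hs -> H != set0 -> H \in visitors (start H).
Proof. by move=> HH H0; rewrite visitorsE inE; apply/orP; left; rewrite inE HH H0 eqxx. Qed.

Lemma homeP H : H \in Hs -> H != set0 ->
  H \in visitors (home H) /\ forall i, H \in visitors i -> i <= home H.
Proof.
move=> HH H0; rewrite /home (negPf H0).
by case: arg_maxnP => [|i vi mx]; [apply: start_visitor | split].
Qed.

Lemma visitor_not_up i c H : H \in visitors i -> i \in desc T c -> ~~ pushed_up H c.
Proof.
elim/(@node_ind _ T): i => i IHi Hi ic; have [<-|nic] := eqVneq i c.
  by case: (visitors_invP i) => nup _ _; apply: nup.
have [i0 pic] := desc_step ic nic.
case: (visitorsP Hi) => [[HH _ es]|[_ Hq _]]; last exact: IHi.
by apply: down_not_up => //; apply: down_desc ic _ => //; rewrite -es; case: (startP H).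
Qed.

Lemma home_not_up c H : H \in Hs -> H != set0 -> home H \in desc T c -> ~~ pushed_up H c.
Proof. by move=> HH H0; apply: visitor_not_up; case: (homeP HH H0). Qed.

Lemma home_not_down c H : H \in Hs -> H != set0 -> home H \notin desc T c -> ~~ pushed_down H c.
Proof.
move=> HH H0; apply: contra => pd; have dc : down H c by rewrite /down pd orbT.
have [vh _] := homeP HH H0; have [_ _ hs] := visitors_mem vh.
exact: desc_trans hs (start_desc HH H0 dc).
Qed.

(** Incomparability beyond the arc would push [H] across it, away from its home. *)
Lemma home_comparable i j H X : tadj T i j -> H \in Hs -> X \in Hs ->
  home H \in side T i j -> home X \in side T i j -> agree (adh T B i j) H X ->
  ~~ incomp (part T B j i) H X.
Proof.
move=> tij HH XH hH hX a.
have [->|H0] := eqVneq H set0; first by rewrite /incomp /exceeds set0I sub0set.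
case/tadjP: tij hH hX a => c c0.
  rewrite side_up // adh_up // part_down // => hH _ a.
  by apply: contra (home_not_up HH H0 hH) => inc; apply/exists_inP; exists X; rewrite // a.
rewrite side_down // adhC adh_up // part_up // inE => hH _ a.
by apply: contra (home_not_down HH H0 hH) => inc; apply/exists_inP; exists X; rewrite // a.
Qed.

(** The union runs over at most one child, so the region is empty when no child has label [b]. *)
Definition kids b i := \bigcup_(c | [&& c != ord0, par T c == i & lab T c == b]) below c.

Lemma kidsP b i : kids b i = set0 \/
  exists c, [/\ c != ord0, par T c = i, lab T c = b & kids b i = below c].
Proof.
case: (pickP (fun c => [&& c != ord0, par T c == i & lab T c == b])) => [c|no]; last first.
  by left; rewrite /kids big_pred0.
case/and3P=> c0 /eqP ec /eqP el; right; exists c; split=> //.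
rewrite /kids (big_pred1 c) // => d /=; apply/and3P/eqP=> [[d0 /eqP ed /eqP ld]|->].
  by apply: (lab_inj (b := T)) => //; rewrite ?ed ?ld.
by rewrite ec el.
Qed.

Lemma below_kids i v : v \in below i -> [\/ v \in B i, v \in kids true i | v \in kids false i].
Proof.
move=> vi; have [|nv] := boolP (v \in B i); first by constructor 1.
have [d [d0 ed vd]] := below_child vi nv.
have vk : v \in kids (lab T d) i by apply/bigcupP; exists d; rewrite ?d0 ?ed ?eqxx.
by move: vk; case: (lab T d); [constructor 2 | constructor 3].
Qed.

Lemma kids_below b i : kids b i \subset below i.
Proof.
case: (kidsP b i) => [->|[c [_ <- _ ->]]]; first exact: sub0set.
by apply: below_desc; apply: child_desc.
Qed.

(** A member that stays either lacks a larger or a smaller companion below the child, hence is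
    extremal because [F] is a chain there, or is held back by a tie. *)
Lemma not_moves_extremal b i H : let F := [set X in visitors i | agree (B i) H X] in
  H \in visitors i -> (forall c, c != ord0 -> par T c = i -> ~~ moves (visitors i) c H) ->
  {in F &, forall A X, ~~ incomp (kids b i) A X} ->
  (exists b', extremal b' F (kids b i) H) \/
  exists X, [/\ X \in F, agree (kids b i) H X &
    if b then smaller (below i) H X else smaller (below i) X H].
Proof.
move=> F Hi nm ni; case: (kidsP b i) => [k0|[c [c0 ec el kb]]].
  left; exists true; apply/forall_inP=> X _.
  by rewrite k0 /exceeds setI0 sub0set.
rewrite kb in ni *; have HF : H \in F by rewrite inE Hi /agree eqxx.
have := nm c c0 ec; rewrite /moves negb_and negbK => /orP[|/exists_inP[X Xi]]; last first.
  rewrite ec el => /and3P[aX bX sX]; right; exists X; split=> //; by rewrite inE Xi.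
rewrite negb_and => /orP[] /exists_inP no; left.
  exists true; apply/forall_inP=> X XF; apply/negP=> /= ex; apply: no.
  have := ni H X HF XF; rewrite /incomp ex andbT => nex.
  by move: XF; rewrite inE => /andP[Xi aX]; exists X; rewrite // ec aX /smaller nex.
exists false; apply/forall_inP=> X XF; apply/negP=> /= ex; apply: no.
have := ni H X HF XF; rewrite /incomp ex /= => nex.
by move: XF; rewrite inE => /andP[Xi aX]; exists X; rewrite // ec aX /smaller nex.
Qed.

(** Members are sorted by their trace on the bag, with at most [2 ^ n] traces; [card_extremal_le6],
    applied to the visitors with a given trace and the regions of the two children, bounds each
    class by six. *)
Lemma homes_card n i : #|B i| <= n ->
  #|[set H in Hs | (H != set0) && (home H == i)]| <= 6 * 2 ^ n.
Proof.
move=> Bn; set G := [set H in Hs | _].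
apply: leq_trans (_ : 6 * #|powerset (B i)| <= _); last first.
  by rewrite leq_mul2l card_powerset leq_exp2l.
apply: (@card_fibers _ _ _ _ (fun H => H :&: B i)) => [H _|P _].
  by rewrite powersetE subsetIr.
have [->|[H0]] := set_0Vmem [set x in G | x :&: B i == P]; first by rewrite cards0.
rewrite inE => /andP[H0G /eqP eP].
pose F := [set X in visitors i | agree (B i) H0 X].
have [_ ndn inj] := visitors_invP i.
have FB : {in F &, forall A X, agree (B i) A X}.
  move=> A X; rewrite !inE => /andP[_ aA] /andP[_ aX].
  by apply: agree_trans aX; rewrite agree_sym.
have Fv A : A \in F -> A \in visitors i by rewrite inE => /andP[].
have FH A : A \in F -> A \in Hs by move/Fv/visitors_mem; case.
have GF H : H \in [set x in G | x :&: B i == P] -> H \in F.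
  case/setIdP=> /setIdP[HH /andP[nH /eqP eh]] /eqP eP'.
  by rewrite inE /agree eP eP' eqxx andbT -eh; case: (homeP HH nH).
have nomove H : H \in [set x in G | x :&: B i == P] ->
    forall c, c != ord0 -> par T c = i -> ~~ moves (visitors i) c H.
  case/setIdP=> /setIdP[HH /andP[nH /eqP eh]] _ c c0 ec; apply/negP=> mv.
  have [vh mx] := homeP HH nH; have vc : H \in visitors c.
    by rewrite visitorsE in_setU; apply/orP; right; rewrite inE ec c0 mv -eh vh.
  by have := mx c vc; rewrite eh -ec leqNgt par_lt.
have ni b : {in F &, forall A X, ~~ incomp (kids b i) A X}.
  move=> A X AF XF; case: (kidsP b i) => [->|[c [c0 ec _ ->]]].
    by rewrite /incomp /exceeds setI0 sub0set.
  apply: contra (ndn A c (Fv A AF) c0 ec) => inc; apply/orP; right.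
  apply/exists_inP; exists X; first exact: FH.
  by rewrite inc andbT; apply: agree_sub (FB A X AF XF); rewrite -ec seam_par.
have FE H : H \in F -> F = [set X in visitors i | agree (B i) H X].
  move=> HF; apply/setP=> X; rewrite !inE; case: (boolP (X \in visitors i)) => //= Xi.
  have aH : agree (B i) H0 H by move: HF; rewrite inE => /andP[].
  apply/idP/idP=> aX; last exact: agree_trans aX.
  by apply: agree_trans aX; rewrite agree_sym.
have other b H X : H \in F -> X \in F -> agree (kids b i) H X -> exceeds (below i) H X ->
    exceeds (kids (~~ b) i) H X.
  move=> HF XF aX /exceedsP[v [vi vH vX]]; apply/exceedsP; exists v; split=> //.
  have nv D : agree D H X -> v \notin D.
    by move/agreeP=> a; apply/negP=> vD; move: (a v vD); rewrite vH (negPf vX).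
  case: (below_kids vi); first by rewrite (negPf (nv _ (FB H X HF XF))).
    by case: b aX => // /nv/negPf->.
  by case: b aX => // /nv/negPf->.
apply: (@card_extremal_le6 _ F _ (kids true i) (kids false i)) => //.
- by apply/subsetP.
(* The region below one child lies above the other child, so no difference can meet both. *)
- move=> A X AF XF; case: (kidsP true i) => [->|[c [c0 ec lc ->]]].
    by rewrite {1}/exceeds setI0 sub0set.
  case: (kidsP false i) => [->|[d [d0 ed ld ->]]].
    by rewrite {2}/exceeds setI0 sub0set.
  move=> e1 e2; apply: (@pair_below_above c A X) => //; try exact: FH.
    by apply: agree_sub (FB A X AF XF); rewrite -ec seam_par.
  apply: exceeds_sub e2; apply: below_above; apply/pred0P=> k /=.
  apply/negP=> /andP[kd kc]; have := @siblings_disjoint _ T d c k d0 c0.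
  rewrite ed ec kd kc => /(_ erefl); case: eqVneq => [e|_ /(_ isT isT)//].
  by move: lc; rewrite -e ld.
- move=> A X AF XF a1 a2; apply: inj; [exact: Fv|exact: Fv|].
  apply/agreeP=> v /below_kids[] vk; [apply/(agreeP _ _ _ (FB A X AF XF))|..] => //.
    by apply/(agreeP _ _ _ a1).
  by apply/(agreeP _ _ _ a2).
- move=> H HG; have HF := GF H HG; have := ni true; rewrite (FE H HF) => ni'.
  case: (@not_moves_extremal true i H _ (nomove H HG) ni') => [|[b' eb']|[X [XF aX /andP[s1 s2]]]]; first exact: Fv.
    by left; exists b'.
  right; exists X; split=> //; rewrite -(FE H HF) in XF; apply/andP; split.
    by apply: contra s1; apply: exceeds_sub; apply: kids_below.
  by apply: (other true) => //; rewrite agree_sym.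
move=> H HG; have HF := GF H HG; have := ni false; rewrite (FE H HF) => ni'.
case: (@not_moves_extremal false i H _ (nomove H HG) ni') => [|[b' eb']|[X [XF aX /andP[s1 s2]]]]; first exact: Fv.
  by left; exists b'.
right; exists X; split=> //; rewrite -(FE H HF) in XF; apply/andP; split.
  by apply: contra s1; apply: exceeds_sub; apply: kids_below.
by apply: (other false).
Qed.

End Homes.

(** * Representatives of the members crossing an arc *)

Section Dual.
Variables (N : nat) (T : btree N) (V : finType) (B : 'I_N.+1 -> {set V}).
Variable Hs : {set {set V}}.
Local Notation I := 'I_N.+1.
Local Notation part := (part T B).
Local Notation adh := (adh T B).
Local Notation home := (home T B Hs).
Implicit Types (i j k c d q : I) (H X R P : {set V}).
Hypothesis cohB : coherent T B.
Hypothesis npH : bag_np B Hs.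
Hypothesis connH : forall H, H \in Hs -> connected_in (shares B) H.
Hypothesis covH : forall H v, H \in Hs -> v \in H -> exists i, v \in B i.

Definition dlocal i := [set H in Hs | home H == i].

Definition dsel i j P (C : {set {set V}}) : option {set V} :=
  [pick R | [&& R \in C, R :&: adh i j == P &
     [forall X in C, (X :&: adh i j == P) ==> (#|X :&: part j i| <= #|R :&: part j i|)]]].

Lemma dsel_in i j P C R : dsel i j P C = Some R -> R \in C.
Proof. by rewrite /dsel; case: pickP => // x /and3P[xC _ _] [<-]. Qed.

Lemma dsel_exists i j (C : {set {set V}}) X : X \in C -> exists R, [/\ dsel i j (X :&: adh i j) C = Some R,
  agree (adh i j) X R & #|X :&: part j i| <= #|R :&: part j i|].
Proof.
move=> XC; rewrite /dsel; case: pickP => [R /and3P[RC /eqP eR /forall_inP mx]|no].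
  exists R; split=> //; first by rewrite /agree eR.
  by have := mx X XC; rewrite eqxx.
pose p Y := (Y \in C) && (Y :&: adh i j == X :&: adh i j).
have XP : p X by rewrite /p XC eqxx.
case: (arg_maxnP (fun Y : {set V} => #|Y :&: part j i|) XP) => R /andP[RC eR] mx; have := no R; rewrite RC eR /=.
move/forall_inP; case=> Y YC; apply/implyP=> eY; apply: mx; by rewrite /p YC.
Qed.

Local Notation carriedD := (carried T B dlocal dsel).
Local Notation candD := (candidates T B dlocal dsel).

Lemma carried_home i j R : tadj T i j -> R \in carriedD i j -> R \in Hs /\ home R \in side T i j.
Proof.
move=> tij; elim/arc_ind: i j / tij R => i j tij IH R /(carried_sub dsel_in tij) /candidatesP[].
  by rewrite inE => /andP[RH /eqP ->]; split=> //; apply: side_refl.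
case=> c [tci ncj Rc]; have [RH hR] := IH c tci ncj R Rc; split=> //.
exact: (subsetP (side_sub tij tci ncj)).
Qed.

(** Either [H] is local or an arc entering [i] carries some [R0] containing it beyond. By
    [home_comparable], [R0] is comparable beyond [i -> j] with the selected [R] of the same trace,
    and the maximal size of [R] turns this into inclusion. *)
Lemma carried_covers i j H : tadj T i j -> H \in Hs -> home H \in side T i j ->
  exists2 R, R \in carriedD i j & ~~ exceeds (part j i) H R.
Proof.
move=> tij; elim/arc_ind: i j / tij H => i j tij IH H HH hH.
have tji : tadj T j i by rewrite tadj_sym.
suff [R0 [RC RH hR] nR] : exists2 R0, [/\ R0 \in candD i j, R0 \in Hs & home R0 \in side T i j]
    & ~~ exceeds (part j i) H R0.
  have [R [eR aR le]] := dsel_exists i j RC.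
  have Rc : R \in carriedD i j by apply: (mem_carried tij _ eR); apply: subsetIr.
  exists R => //; have [RH' hR'] := carried_home tij Rc.
  have ni := home_comparable cohB npH connH covH tij RH RH' hR hR' aR.
  have nRR : ~~ exceeds (part j i) R0 R.
    apply/negP=> e; move: ni; rewrite /incomp e /= negbK => s.
    have : R :&: part j i \proper R0 :&: part j i.
      rewrite properE !subsetI s !subsetIr /= andbT; exact: e.
    by move/proper_card; rewrite ltnNge le.
  apply/exceedsP=> -[v [vp vH vR]]; case/negP: vR.
  by apply: (exceedsPn nRR) => //; apply: (exceedsPn nR).
have [eh|nh] := eqVneq (home H) i.
  exists H; last by rewrite /exceeds negbK subsetIl.
  by split=> //; apply: Loc_candidates; rewrite inE HH eh eqxx.
have [c [tci ncj hc]] := side_next tij hH nh.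
have [R0 Rc nR] := IH c tci ncj H HH hc; have [RH hR] := carried_home tci Rc.
exists R0; last by apply: contra nR; apply: exceeds_sub; apply: part_sub; apply: side_subC.
split=> //; first exact: carried_candidates Rc.
exact: (subsetP (side_sub tij tci ncj)).
Qed.

(** Locally there are [6 * 2 ^ n] homes and possibly the empty set; another [6 * 2 ^ n] members are
    carried. For the last clause, walk from the home of [H] to [j]: on each arc the representative
    covering [H] contains [v], which lies beyond. *)
Lemma dual_bags n : (forall i, #|B i| <= n) ->
  exists C : I -> {set {set V}}, [/\ coherent T C, forall i, C i \subset Hs,
    forall H, H \in Hs -> exists i, H \in C i, forall i, #|C i| <= 12 * 2 ^ n + 1 &
    forall v j H, v \in B j -> H \in Hs -> v \in H ->
      exists R, [/\ R \in Hs, v \in R, R \in C j &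
        connect (induced (shares C) [set X in Hs | v \in X]) H R]].
Proof.
move=> Bn; exists (sbag T B dlocal dsel); split.
- move=> H; have -> : [set i | H \in sbag T B dlocal dsel i] = spread T B dlocal dsel H.
    by apply/setP=> i; rewrite !inE.
  apply: (spread_connected dsel_in) => i j; rewrite !inE => /andP[_ /eqP <-] /andP[_ /eqP <-].
  exact: connect0.
- move=> i; apply/subsetP=> H; rewrite 2!inE => /orP[/setIdP[]//|/existsP[j /andP[tij]]].
  by case/orP=> /carried_home-[]; rewrite // tadj_sym.
- move=> H HH; exists (home H); apply: (subsetP (Loc_sbag _ _ _ _ _)); by rewrite inE HH eqxx.
- move=> i; apply: leq_trans (sbag_card _ _ _ cohB Bn) _.
  have sub : dlocal i \subset set0 |: [set H in Hs | (H != set0) && (home H == i)].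
    by apply/subsetP=> H; rewrite !inE => /andP[-> ->]; case: eqP.
  have : #|dlocal i| <= 1 + 6 * 2 ^ n.
    apply: leq_trans (subset_leq_card sub) _; apply: leq_trans (leq_card_setU _ _) _.
    by rewrite cards1 leq_add2l; apply: (homes_card cohB npH connH covH (Bn i)).
  move=> le; lia.
move=> v j H vj HH vH; set X := [set _ in _ | _].
have HX : H \in X by rewrite inE HH.
have Hh : H \in sbag T B dlocal dsel (home H).
  by apply: (subsetP (Loc_sbag _ _ _ _ _)); rewrite inE HH eqxx.
have [k k' /and3P[tkk hk jk]|R [RX Rj cR]] := towards_chain (T := T) (j0 := j) HX Hh.
  have [R Rc nR] := carried_covers tkk HH hk; have [RH _] := carried_home tkk Rc.
  have [R1 R2] := carried_sbag tkk Rc; exists R; split=> //.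
  by rewrite inE RH; apply: (exceedsPn nR) => //; apply: mem_part vj jk.
by exists R; split=> //; move: RX; rewrite inE => /andP[].
Qed.

End Dual.

(** * From trees to binary trees *)

Section Binarise.
Variable q : nat -> nat.
Hypothesis q_lt : forall k, 0 < k -> q k < k.

(* Node [2k] stands for the original node [k]; node [2k-1] is a copy of the parent [q k], and the copies belonging to the children of one node form a chain hanging from it. *)
Definition prev_sibling k := \max_(s < k | (0 < s) && (q s == q k)) s.
(** The value [0] of [prev_sibling] marks a first child, node [0] being the root; [s.*2.+1] is the
    copy belonging to the sibling [s.+1]. *)
Definition bpar i :=
  if odd i then
    if prev_sibling (uphalf i) is s.+1 then s.*2.+1 else (q (uphalf i)).*2
  else i.-1.
Definition origin i := if odd i then q (uphalf i) else i./2.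

Lemma prev_sibling_ge s k : 0 < s < k -> q s = q k -> s <= prev_sibling k.
Proof.
move=> /andP[s0 sk] e.
have := @leq_bigmax_cond _ (fun s : 'I_k => (0 < s) && (q s == q k)) (fun s => s) (Ordinal sk).
by apply; rewrite /= s0 e eqxx.
Qed.

Lemma prev_siblingP k : 0 < prev_sibling k -> prev_sibling k < k /\ q (prev_sibling k) = q k.
Proof.
rewrite /prev_sibling; elim/big_ind: _ => // [x y hx hy|s /andP[s0 /eqP e] _]; last by split.
by rewrite /maxn; case: ifP.
Qed.

Lemma bpar_lt i : 0 < i -> bpar i < i.
Proof.
move=> i0; rewrite /bpar; case: ifP => [oi|_]; last by rewrite prednK.
case e : (prev_sibling (uphalf i)) => [|s]; first by have := @q_lt (uphalf i); lia.
have := @prev_siblingP (uphalf i); rewrite e => /(_ isT)[]; lia.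
Qed.

(** Parity is the label. Positive even nodes have distinct predecessors; two copies with one parent
    would have the same previous sibling or none, against [prev_sibling_ge] for the larger one. *)
Lemma bpar_inj i j : 0 < i -> 0 < j -> bpar i = bpar j -> odd i = odd j -> i = j.
Proof.
move=> i0 j0; rewrite /bpar => e o; move: e; rewrite -o; case: ifP => oi; last by lia.
have main k l : 0 < k < l ->
    (if prev_sibling k is s.+1 then s.*2.+1 else (q k).*2) =
    (if prev_sibling l is s.+1 then s.*2.+1 else (q l).*2) -> False.
  move=> kl; have pk := @prev_siblingP k; have pl := @prev_siblingP l.
  have ge := @prev_sibling_ge k l kl.
  case ek : (prev_sibling k) pk => [|s] pk; case el : (prev_sibling l) pl => [|t] pl.
  - move=> e; have : q k = q l by lia.
    by move/ge; rewrite el; lia.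
  - by move=> e; lia.
  - by move=> e; lia.
  move=> e; have est : s = t by lia.
  case: (pk isT) => ltk eqk; case: (pl isT) => ltl eql.
  have : q k = q l by rewrite -eqk -eql est.
  by move/ge; rewrite el; lia.
move=> e; have [lt|lt|eh] := ltngtP (uphalf i) (uphalf j).
- by case: (main _ _ _ e); lia.
- by case: (main _ _ _ (esym e)); lia.
- lia.
Qed.

Variable m : nat.
Let N := m.*2.

Lemma bpar_bound (i : 'I_N.+1) : bpar i < N.+1.
Proof.
have [i0|i0] := posnP i; first by rewrite i0.
by apply: leq_trans (bpar_lt i0) _; apply: ltnW.
Qed.

Definition bparo (i : 'I_N.+1) : 'I_N.+1 := Ordinal (bpar_bound i).

Lemma bparo0 : bparo ord0 = ord0. Proof. exact: val_inj. Qed.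

Lemma bparo_lt i : i != ord0 -> bparo i < i.
Proof. by move=> i0; apply: bpar_lt; rewrite lt0n. Qed.

Lemma bparo_inj c d : c != ord0 -> d != ord0 -> bparo c = bparo d -> odd c = odd d -> c = d.
Proof.
by move=> c0 d0 [e] o; apply/val_inj/bpar_inj; rewrite // lt0n.
Qed.

Definition binary : btree N := BTree bparo0 bparo_lt bparo_inj.

Lemma binary_step (X : pred nat) (i : 'I_N.+1) : i != ord0 -> X (origin i) -> X (origin (bparo i)) ->
  connect (induced (tadj binary) [set i : 'I_N.+1 | X (origin i)]) i (bparo i).
Proof.
move=> i0 Xi Xp; apply: connect1; rewrite /induced /= !inE Xi Xp !andbT.
exact: (@tadj_par _ binary).
Qed.

(** Up the chain of copies every node has origin [q k], so the path stays in the set until it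
    reaches the original node. *)
Lemma binary_copy (X : pred nat) k (i j : 'I_N.+1) : X (q k) -> 0 < k -> i.+1 = k.*2 :> nat ->
  j = (q k).*2 :> nat -> connect (induced (tadj binary) [set i : 'I_N.+1 | X (origin i)]) i j.
Proof.
have [n] := ubnP k; elim: n k i j => // n IHn k i j kn Xk k0 ei ej.
have oi : odd i by lia.
have uk : uphalf i = k by lia.
have i0 : i != ord0 by apply: contraTneq oi => ->.
have Xi : X (origin i) by rewrite /origin oi uk.
case e : (prev_sibling k) => [|s].
  have -> : j = bparo i by apply: val_inj; rewrite /= /bpar oi uk e.
  by apply: binary_step => //; rewrite /= /bpar oi uk e /origin odd_double doubleK.
have := @prev_siblingP k; rewrite e => /(_ isT)[lts es].
have ep : bparo i = s.*2.+1 :> nat by rewrite /= /bpar oi uk e.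
have eo : origin s.*2.+1 = q s.+1.
  rewrite /origin; have -> : uphalf s.*2.+1 = s.+1 by lia.
  by rewrite /= odd_double.
apply: connect_trans (binary_step i0 Xi _) _.
  by rewrite ep eo es.
apply: (IHn s.+1); rewrite ?es ?ep //; lia.
Qed.

Lemma binary_edge (X : pred nat) k (i j : 'I_N.+1) : X k -> X (q k) -> 0 < k -> i = k.*2 :> nat ->
  j = (q k).*2 :> nat -> connect (induced (tadj binary) [set i : 'I_N.+1 | X (origin i)]) i j.
Proof.
move=> Xk Xq k0 ei ej; have i0 : i != ord0 by rewrite -val_eqE /= ei; lia.
have ep : bparo i = i.-1 :> nat by rewrite /= /bpar ei odd_double.
apply: connect_trans (binary_step i0 _ _) _.
- by rewrite /origin ei odd_double doubleK.
- rewrite ep /origin ei; have -> : odd k.*2.-1 by lia.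
  by have -> : uphalf k.*2.-1 = k by lia.
by apply: (binary_copy (k := k)) => //; rewrite ep ei; lia.
Qed.

End Binarise.

(** While some vertex is missing from the list, [connected_cut] yields an edge leaving it, whose
    outer end is appended. *)
Lemma tree_enum (I : finType) (r : rel I) x0 : symmetric r -> connected_in r [set: I] ->
  forall k, 0 < k <= #|I| -> exists s, [/\ uniq s, size s = k &
    forall j, 0 < j < k -> has (r (nth x0 s j)) (take j s)].
Proof.
move=> rs cI; elim=> // -[|k] IHk /andP[_ le]; first by exists [:: x0]; split=> // -[|j].
have [|s [us ss hs]] := IHk; first exact: ltnW.
have [w0 w0s] : exists w, w \notin s.
  apply/existsP; rewrite -negb_forall; apply/negP=> /forallP all_s.
  have : #|I| <= size s by rewrite -(card_uniqP us); apply/subset_leq_card/subsetP=> y _; apply: all_s.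
  by rewrite ss leqNgt le.
have hd : nth x0 s 0 \in s by rewrite mem_nth // ss.
have [||u [w []]] := @connected_cut _ _ _ [set z in s] _ w0 cI (in_setT (nth x0 s 0)) (in_setT _).
- by rewrite inE.
- by rewrite inE.
rewrite !inE => _ _ ruw us' ws; exists (rcons s w); split.
- by rewrite rcons_uniq ws.
- by rewrite size_rcons ss.
move=> j /andP[j0]; rewrite ltnS leq_eqVlt => /orP[/eqP->|ltj].
  rewrite nth_rcons ss ltnn eqxx -cats1 takel_cat ?ss // take_oversize ?ss //.
  by apply/hasP; exists u; rewrite // rs.
by rewrite nth_rcons ss ltj -cats1 takel_cat ?ss 1?ltnW // hs // j0.
Qed.

(** The edges from each later vertex to its chosen earlier neighbour already number [#|I| - 1], so
    the edge count of a tree leaves no others. *)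
Lemma tree_parent (I : finType) (r : rel I) : is_tree r ->
  exists s : seq I, exists q : nat -> nat, [/\ uniq s, size s = #|I|, forall k, 0 < k -> q k < k &
    forall x y, r x y -> exists2 k, 0 < k & 
      (index x s = k /\ index y s = q k) \/ (index y s = k /\ index x s = q k)].
Proof.
case=> -[rs ri] I0 cI cE; have /card_gt0P[x0 _] := I0.
have [|s [us ss hs]] := @tree_enum I r x0 rs cI #|I|; first by rewrite I0 leqnn.
have mems y : y \in s.
  have /subset_cardP : #|s| = #|I| by rewrite (card_uniqP us).
  by move/(_ (subset_predT _)) ->.
(* Outside the range, the value [0] keeps [q k < k] for every positive [k]. *)
pose q k := if 0 < k < #|I| then find (r (nth x0 s k)) s else 0.
have q_lt k : 0 < k -> q k < k.
  rewrite /q => k0; case: ifP => // kI; have h := hs k kI; rewrite -(cat_take_drop k s) find_cat.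
  rewrite cat_take_drop h; move: h; rewrite has_find => /leq_trans; apply.
  by rewrite size_take; case: ltnP.
have q_r k : 0 < k < #|I| -> r (nth x0 s k) (nth x0 s (q k)).
  move=> kI; rewrite /q kI; apply: nth_find; have /hasP[u /mem_take us' ru] := hs k kI.
  by apply/hasP; exists u.
exists s, q; split=> //.
pose U := [set k : 'I_#|I| | 0 < k].
pose f (k : 'I_#|I|) := (nth x0 s k, nth x0 s (q k)); pose g (k : 'I_#|I|) := (nth x0 s (q k), nth x0 s k).
have ninj a b : a < #|I| -> b < #|I| -> nth x0 s a = nth x0 s b -> a = b.
  by move=> aI bI /eqP; rewrite nth_uniq ?ss // => /eqP.
have fi : injective f by move=> a b [/ninj e _]; apply/val_inj/e.
have gi : injective g by move=> a b [_ /ninj e]; apply/val_inj/e.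
have qI (k : 'I_#|I|) : q k < #|I|.
  have [k0|k0] := posnP k; first by rewrite k0 /q.
  exact: ltn_trans (q_lt k k0) _.
have cU : #|U| = #|I| - 1.
  pose z : 'I_#|I| := Ordinal I0; have := cardC1 z; rewrite card_ord subn1; apply: etrans.
  by apply: eq_card => k; rewrite !inE -val_eqE lt0n.
have sub : f @: U :|: g @: U \subset [set p | r p.1 p.2].
  apply/subsetP=> p /setUP[] /imsetP[k]; rewrite !inE => k0 -> /=.
    by apply: q_r; rewrite k0 /=.
  by rewrite rs; apply: q_r; rewrite k0 /=.
have disj : f @: U :&: g @: U = set0.
  apply/setP=> -[a b]; rewrite [in RHS]inE in_setI.
  apply/andP=> -[/imsetP[k]]; rewrite inE => k0 [-> ->] /imsetP[l]; rewrite inE => l0 [].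
  move=> /ninj e1 /ninj e2; have := q_lt k k0; have := q_lt l l0.
  by rewrite -e1 // e2 // => /ltnW; rewrite leqNgt => /negP.
have eE : f @: U :|: g @: U = [set p | r p.1 p.2].
  apply/eqP; rewrite eqEcard sub cE cardsU disj cards0 subn0 !card_imset // cU.
  lia.
move=> x y rxy; have : (x, y) \in f @: U :|: g @: U by rewrite eE inE.
have idx k : k < #|I| -> index (nth x0 s k) s = k by move=> kI; rewrite index_uniq ?ss.
case/setUP=> /imsetP[k]; rewrite inE => k0 [-> ->]; exists (val k) => //; rewrite !idx //.
  by left.
by right.
Qed.

(** Each binary node takes the bag of its origin; copies are linked to the original node by
    [binary_copy], and original nodes to each other by [binary_edge]. *)
Lemma binary_decomposition (I V : finType) (r : rel I) (B : I -> {set V}) :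
  is_tree r -> (forall v, connected_in r [set i | v \in B i]) ->
  exists N (T : btree N) (f : 'I_N.+1 -> I),
    coherent T (fun i => B (f i)) /\ forall x, exists i, f i = x.
Proof.
move=> tr cohB; have [s [q [us ss q_lt rq]]] := tree_parent tr.
have I0 : 0 < #|I| by case: tr.
have /card_gt0P[x0 _] := I0.
pose m := #|I|.-1; have em : m.+1 = #|I| by rewrite prednK.
have mems y : y \in s.
  have /subset_cardP : #|s| = #|I| by rewrite (card_uniqP us).
  by move/(_ (subset_predT _)) ->.
have idxI x : index x s <= m by rewrite -ltnS em -ss index_mem.
pose h x : 'I_(m.*2).+1 := inord (index x s).*2.
have hE x : h x = (index x s).*2 :> nat by rewrite inordK // ltnS leq_double.
pose f (i : 'I_(m.*2).+1) := nth x0 s (origin q i).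
exists m.*2, (binary q_lt m), f; split; last first.
  by move=> x; exists (h x); rewrite /f /origin hE odd_double doubleK nth_index.
move=> v; pose X : pred nat := fun a => v \in B (nth x0 s a).
have -> : [set i | v \in B (f i)] = [set i : 'I_(m.*2).+1 | X (origin q i)] by [].
pose g := induced (tadj (binary q_lt m)) [set i : 'I_(m.*2).+1 | X (origin q i)].
have gs : connect_sym g.
  by apply: sym_connect_sym => a b; rewrite /g /induced /= (tadj_sym (binary q_lt m)) [(a \in _) && _]andbC.
have Xidx x : v \in B x -> X (index x s) by rewrite /X nth_index.
have hh x y : v \in B x -> v \in B y -> connect g (h x) (h y).
  move=> vx vy; have := @cohB v x y; rewrite !inE => /(_ vx vy).
  apply: connect_homo_gen => a b /and3P[rab]; rewrite !inE => va vb.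
  have [k k0 [[ea eb]|[ea eb]]] := rq _ _ rab; last rewrite gs.
    apply: (@binary_edge q q_lt m X k); rewrite ?hE ?ea ?eb //.
      by rewrite -ea; apply: Xidx.
    by rewrite -eb; apply: Xidx.
  apply: (@binary_edge q q_lt m X k); rewrite ?hE ?ea ?eb //.
    by rewrite -ea; apply: Xidx.
  by rewrite -eb; apply: Xidx.
have toh (i : 'I_(m.*2).+1) : X (origin q i) -> exists2 x, v \in B x & connect g i (h x).
  rewrite /origin; case: ifP => oi Xi; last first.
    exists (nth x0 s i./2) => //; have -> : h (nth x0 s i./2) = i; last exact: connect0.
    apply: val_inj; rewrite [LHS]hE index_uniq //; first by have := odd_double_half i; rewrite oi.
    by rewrite ss -em; have := ltn_ord i; lia.
  exists (nth x0 s (q (uphalf i))) => //; apply: (@binary_copy q q_lt m X (uphalf i)) => //.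
  - by have := odd_gt0 oi; lia.
  - by lia.
  rewrite hE index_uniq // ss -em; have := q_lt (uphalf i); have := ltn_ord i; have := odd_gt0 oi; lia.
move=> i j; rewrite -/g !inE => /toh[x vx cx] /toh[y vy cy].
by apply: connect_trans cx (connect_trans (hh x y vx vy) _); rewrite gs.
Qed.

(** * The support *)

Lemma connected_in_mono (V : finType) (e e' : rel V) (X : {set V}) :
  {in X &, forall u v, e u v -> e' u v} -> connected_in e X -> connected_in e' X.
Proof.
move=> sub cX x y xX yX; apply: (@connect_homo_gen _ _ _ _ id) (cX x y xX yX) => u v.
by case/and3P=> euv uX vX; apply: connect1; rewrite /induced /= uX vX !andbT sub.
Qed.

(** On the left is the bound of [dual_bags] for the bag size that [primal_bags] gives from bags of
    size [t.+1]; the final [.+1] is the gap between bag size and width. *)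
Lemma support_width_le t :
  12 * 2 ^ (t.+1 + 6 * 2 ^ t.+1) + 1 <= (2 ^ (2 ^ (t + 4) + 4 * (t + 1))).+1.
Proof.
rewrite addn1 ltnS; set n := t.+1 + _.
have le : n + 4 <= 2 ^ (t + 4) + 4 * (t + 1).
  by rewrite /n expnD expnS; have := expn_gt0 2 t; lia.
by apply: leq_trans (_ : 2 ^ (n + 4) <= _); [rewrite expnD; lia | rewrite leq_exp2l].
Qed.

Unset Implicit Arguments.

Theorem mainTheorem3 (V : finType) (e : rel V) (t : nat)
    (Hs Ks : {set {set V}}) :
  simple_graph e ->
  treewidth_eq [set: V] e t ->
  non_piercing e Hs -> non_piercing e Ks ->
  exists Q : rel {set V},
    intersection_support Hs Ks Q /\
    tw_le Hs Q (2 ^ (2 ^ (t + 4) + 4 * (t + 1))).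
Proof.
move=> _ [[I [r [B0 [tr [_ [cov0 [edge0 [conn0 size0]]]]]]]] _] [connH npH] [_ npK].
have [N [T [f [cohB f_onto]]]] := @binary_decomposition _ _ r B0 tr (fun v => conn0 v (in_setT v)).
pose B i := B0 (f i).
have covB v : exists i, v \in B i.
  by have [x vx] := cov0 v (in_setT v); have [i ei] := f_onto x; exists i; rewrite /B ei.
have edgeB u v : e u v -> exists i, (u \in B i) && (v \in B i).
  move=> euv; have [x uvx] := edge0 u v (in_setT u) (in_setT v) euv.
  by have [i ei] := f_onto x; exists i; rewrite /B ei.
have sizeB i : #|B i| <= t.+1 by apply: size0.
pose S := \bigcup_(H in Hs) H.
have HS (H : {set V}) : H \in Hs -> H \subset S by move=> HH; apply: bigcup_sup HH.
have npKB : bag_np B Ks.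
  move=> K K' KK KK'; apply: connected_in_mono (npK K K' KK KK') => u v _ _ /edgeB[i uvi].
  by apply/existsP; exists i.
have [B' [cohB' subB' sizeB' connK]] := @primal_bags _ T _ B Ks S cohB covB npKB _ sizeB.
(* An edge inside [S] lies in a new bag, since the new bags contain the old ones cut down to [S]. *)
have mono (X : {set V}) : X \subset S -> connected_in e X -> connected_in (shares B') X.
  move=> /subsetP XS; apply: connected_in_mono => u v uX vX /edgeB[i /andP[ui vi]].
  by apply/existsP; exists i; rewrite !(subsetP (subB' i)) // inE ?ui ?vi XS.
have npH' : bag_np B' Hs.
  move=> H H' HH HH'; apply: mono (npH H H' HH HH').
  exact: subset_trans (subsetDl _ _) (HS H HH).
have connH' (H : {set V}) : H \in Hs -> connected_in (shares B') H.
  by move=> HH; apply: mono (connH H HH); apply: HS.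
have covS v : v \in S -> exists i, v \in B' i.
  move=> vS; have [i vi] := covB v; exists i; apply: (subsetP (subB' i)); by rewrite inE vi.
have covH (H : {set V}) v : H \in Hs -> v \in H -> exists i, v \in B' i.
  by move=> HH vH; apply: covS; apply: (subsetP (HS H HH)).
have [C [cohC CH CHs sizeC linkC]] := dual_bags cohB' npH' connH' covH sizeB'.
(* Removing the loops of [shares C] makes the support simple. *)
pose Q : rel {set V} := [rel H H' | (H != H') && shares C H H'].
exists Q; split; last first.
  exists 'I_N.+1, (tadj T), C; split; first exact: tadj_is_tree.
  split=> //; split=> //; split; last split=> //.
    by move=> H H' _ _ /andP[_ /existsP].
  by move=> i; apply: leq_trans (sizeC i) (support_width_le t).
split; first split.
- move=> H H'; rewrite /Q /= eq_sym; congr (_ && _).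
  by apply: eq_existsb => i; rewrite andbC.
- by move=> H; rewrite /Q /= eqxx.
split=> [H H' /andP[_ /existsP[i /andP[Hi Hi']]]|K KK].
  by rewrite !(subsetP (CH i)).
set M := meeting Hs K.
have MP v (H : {set V}) : v \in K -> H \in Hs -> v \in H -> H \in M.
  by move=> vK HH vH; rewrite inE HH; apply/set0Pn; exists v; rewrite inE vH.
pose g := induced (shares C) M.
have gs : connect_sym g.
  apply: sym_connect_sym => H H'; rewrite /g /induced /= [(H \in _) && _]andbC; congr (_ && _).
  by apply: eq_existsb => i; rewrite andbC.
have reach v j (H : {set V}) : v \in K -> v \in B' j -> H \in Hs -> v \in H ->
    exists R, [/\ R \in M, R \in C j & connect g H R].
  move=> vK vj HH vH; have [R [RH vR Rj cR]] := linkC v j H vj HH vH.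
  exists R; split=> //; first exact: MP vR.
  apply: (@connect_homo_gen _ _ _ _ id) cR => X Y /and3P[sXY]; rewrite !inE => /andP[XH vX] /andP[YH vY].
  by apply: connect1; rewrite /g /induced /= sXY (MP v X) // (MP v Y).
(* Both members reach, inside [M], representatives lying in the same bag [C j]. *)
have share u v j (H H' : {set V}) : u \in K -> v \in K -> u \in B' j -> v \in B' j ->
    H \in Hs -> H' \in Hs -> u \in H -> v \in H' -> connect g H H'.
  move=> uK vK uj vj HH HH' uH vH'.
  have [R [RM Rj cR]] := reach u j H uK uj HH uH.
  have [R' [RM' Rj' cR']] := reach v j H' vK vj HH' vH'.
  rewrite gs in cR'; apply: connect_trans cR (connect_trans (connect1 _) cR').
  by rewrite /g /induced /= RM RM' !andbT; apply/existsP; exists j; rewrite Rj Rj'.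
suff toQ H H' : H \in M -> H' \in M -> connect g H H'.
  move=> H H' HM HM'; apply: (@connect_homo_gen _ _ _ _ id) (toQ H H' HM HM') => X Y /and3P[sXY XM YM].
  have [->|nXY] := eqVneq X Y; first exact: connect0.
  by apply: connect1; rewrite /induced /= XM YM !andbT /Q /= nXY.
rewrite !inE => /andP[HH /set0Pn[u /setIP[uH uK]]] /andP[HH' /set0Pn[v /setIP[vH' vK]]].
have uS : u \in K :&: S by rewrite inE uK (subsetP (HS H HH)).
have vS : v \in K :&: S by rewrite inE vK (subsetP (HS H' HH')).
have /connectP[s ps ev] := connK K KK u v uS vS.
(* Induction along a path of [K :&: S]: each new vertex lies in some member of [Hs] by the choice of
   [S], and shares a bag with the previous one. *)
elim: s u H HH uH uK uS ps ev => [|w s IHs] u H HH uH uK uS /=.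
  move=> _ ev; rewrite ev in vH' vK; have [j uj] := covH H u HH uH.
  exact: (share u u j).
case/andP=> /and3P[/existsP[j /andP[uj wj]] _ wKS] pw ev.
have [wK /bigcupP[X XH wX]] := setIP wKS.
apply: connect_trans (share u w j H X uK wK uj wj HH XH uH wX) _.
exact: (IHs w X).
Qed.
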